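(* Let $L$ be a finite meet-distributive meet-semilattice. Suppose that the associated distributive lattice $\hat{L}$ of $L$ is a URC lattice. Then the following conditions are equivalent: (a) $L=\hat{L}$. (b) The reduced Gröbner basis of $J_L$ with respect to $<^1_{lex}$ consists of Hibi relations and special linear relations.
   Context: A poset $L$ is a meet-semilattice if every pair of elements of $L$ has a meet in $L$. A finite meet-semilattice $L$ is meet-distributive if each interval $[x,y]$ of $L$ such that $x$ is the meet of the lower neighbors of $y$ in this interval is Boolean. Let $P=\{p_1,\dots,p_n\}$ be the poset of all join-irreducible elements of $L$. The associated distributive lattice $\hat L$ of $L$ is the ideal lattice of $P$, i.e. the lattice of all poset ideals (down-closed subsets, including $\emptyset$) of $P$ ordered by inclusion, with meet intersection and join union. There is a canonical embedding $L\to\hat L$, $l\mapsto\{p\in P : p\le l\}$, through which $L$ is regarded as a subset of $\hat L$. For an interval $[a,b]$ of a lattice and $c,d\in[a,b]$, the set $\{c,d\}$ is a complementary set of $[a,b]$ if $c\vee d=b$, $c\wedge d=a$ and $\{c,d\}\ne\{a,b\}$. A lattice is a URC lattice (uniquely relatively complemented) if every interval $[a,b]$ of it either is a chain or has a unique complementary set. Let $K$ be a field and $S=K[x_1,\dots,x_n,y_1,\dots,y_n]$. For $a\in L$ (regarded as a poset ideal of $P$) put $u_a=\prod_{p_i\in a}x_i\prod_{p_i\notin a}y_i$. Let $H_L=(u_a : a\in L)\subset S$, with Rees algebra $\mathcal{R}(H_L)=S[\{u_at\}_{a\in L}]\subset S[t]$. Let $R=S[\{z_a\}_{a\in L}]$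 be a polynomial ring and let $J_L$ be the kernel of the surjective $K$-algebra homomorphism $\phi:R\to\mathcal{R}(H_L)$ with $\phi(x_i)=x_i$, $\phi(y_i)=y_i$, $\phi(z_a)=u_at$. The term order $<^1_{lex}$ on $R$ is the product order of the lexicographic order on $S$ induced by $x_1>\cdots>x_n>y_1>\cdots>y_n$ and a rank lexicographic order on $K[\{z_a\}_{a\in L}]$, i.e. a lexicographic order induced by a total order of the variables with $z_a<z_b$ whenever $\operatorname{rank}a<\operatorname{rank}b$; the $S$-part is compared first, so that $x_i>y_j>z_a$ for all $i,j,a$. Here $\operatorname{rank}a$ is the maximal length of a chain descending from $a$. The Hibi relations are the (nonzero) binomials $z_az_b-z_{a\wedge b}z_{a\vee b}$ with $a,b\in L$ incomparable and such that $a\vee b$ exists in $L$, regarded up to sign. The special linear relations are the binomials $x_iz_{a_1}-y_iz_{a_2}$ where $a_1,a_2\in L$ satisfy $a_2=a_1\cup\{p_i\}$ with $p_i\notin a_1$ (as poset ideals of $P$). *)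

(* Defs.v *)
From HB Require Import structures.
From mathcomp Require Import all_boot all_order all_algebra.
From mathcomp.multinomials Require Import mpoly.

Set Implicit Arguments.
Unset Strict Implicit.
Unset Printing Implicit Defensive.

Import Order.TTheory GRing.Theory.
Import Order.DefaultSetSubsetOrder.

Local Open Scope order_scope.

Section Posets.
Context {d : Order.disp_t} {T : finPOrderType d}.
Implicit Types (a b c x y z : T) (C : {set T}).

Definition itv x y z : bool := x <= z <= y.

Definition is_chain (A : pred T) : bool :=
  [forall x, forall y, A x ==> A y ==> (x >=< y)].

Definition covers y z : bool := (z < y) && [forall w, ~~ (z < w < y)].

(* The length of a chain with k elements is k - 1. *)
Definition rank a : nat :=
  \max_(C : {set T} | [&& a \in C, [forall x in C, x <= a] & is_chain (mem C)])
    #|C|.-1.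

(* c is the (possibly non-existing) join of a and b. *)
Definition is_join a b c : bool :=
  [forall e, (c <= e) == (a <= e) && (b <= e)].

Definition join_irreducible a : bool :=
  [exists x, ~~ (a <= x)] &&
  [forall x, forall y, is_join x y a ==> (a == x) || (a == y)].

(* [x, y] is isomorphic to the lattice of subsets of a finite set. *)
Definition boolean_itv x y : Prop :=
  exists (n : nat) (f : {set 'I_n} -> T),
    (forall A B, (f A <= f B) = (A \subset B)) /\
    (forall z, itv x y z <-> exists A, f A = z).

Definition poset_ideal C : bool :=
  [forall x in C, forall y, (y <= x) ==> (y \in C)].

End Posets.

(* Inside [x, y], the meet of the empty family is y; it is only needed for
   x = y. *)
Definition meet_distributive d (L : finMeetSemilatticeType d) : Prop :=
  forall x y : L, x <= y ->
    \big[Order.meet/y]_(z | itv x y z && covers y z) z = x ->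
    boolean_itv x y.

Definition complementary_set d (T : finLatticeType d) (a b : T) (C : {set T}) :
    Prop :=
  exists c e : T, [/\ C = [set c; e], itv a b c && itv a b e,
    c `|` e = b, c `&` e = a & C != [set a; b]].

Definition URC d (T : finLatticeType d) : Prop :=
  forall a b : T, a <= b ->
    is_chain (itv a b) \/ exists! C : {set T}, complementary_set a b C.

Section IdealLattice.
Context {d : Order.disp_t} (P : finPOrderType d).

Definition ideal_lattice : Type := {I : {set P} | poset_ideal I}.

Lemma poset_idealP (I : {set P}) :
  reflect (forall x y, x \in I -> y <= x -> y \in I) (poset_ideal I).
Proof.
apply: (iffP forall_inP) => [H x y xI yx | H x xI].
  by have /forallP/(_ y)/implyP := H x xI; apply.
by apply/forallP => y; apply/implyP; apply: H.
Qed.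

Fact poset_idealI :
  meet_closed (fun I : {set P} => poset_ideal I).
Proof.
move=> I J /poset_idealP HI /poset_idealP HJ; apply/poset_idealP => x y.
rewrite !inE => /andP[xI xJ] yx.
by apply/andP; split; [apply: HI xI yx | apply: HJ xJ yx].
Qed.

Fact poset_idealU :
  join_closed (fun I : {set P} => poset_ideal I).
Proof.
move=> I J /poset_idealP HI /poset_idealP HJ; apply/poset_idealP => x y.
rewrite !inE => /orP[xI|xJ] yx; apply/orP; [left | right].
  exact: HI xI yx.
exact: HJ xJ yx.
Qed.

HB.instance Definition _ := SubType.on ideal_lattice.
HB.instance Definition _ := [Finite of ideal_lattice by <:].
HB.instance Definition _ :=
  Order.SubChoice_isSubLattice.Build _ _ _ d ideal_lattice
    poset_idealI poset_idealU.

End IdealLattice.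

Section JoinIrreducibles.
Context {d : Order.disp_t} (L : finMeetSemilatticeType d).

Definition jirr : Type := {p : L | join_irreducible p}.

HB.instance Definition _ := SubType.on jirr.
HB.instance Definition _ := [Finite of jirr by <:].
HB.instance Definition _ := [SubChoice_isSubPOrder of jirr by <: with d].

Definition hat : finLatticeType d := ideal_lattice jirr.

Definition jirr_below (l : L) : {set jirr} := [set p : jirr | val p <= l].

Fact jirr_below_ideal l : poset_ideal (jirr_below l).
Proof.
apply/poset_idealP => x y; rewrite !inE => xl yx.
exact: le_trans xl.
Qed.

Definition embed (l : L) : hat := exist _ (jirr_below l) (jirr_below_ideal l).

End JoinIrreducibles.

Local Open Scope ring_scope.

Section Groebner.
Context {K : fieldType} {k : nat}.
Local Notation R := {mpoly K[k]}.
Implicit Types (lt : rel 'X_{1..k}) (f g : R) (A J : R -> Prop) (G : seq R).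

Definition ideal_span A f : Prop :=
  exists s : seq (R * R),
    (forall q, q \in s -> A q.2) /\ f = \sum_(q <- s) q.1 * q.2.

(* m is the initial monomial of f for the strict order lt; there is none for
   f = 0. *)
Definition is_initial lt f (m : 'X_{1..k}) : Prop :=
  m \in msupp f /\ forall m', m' \in msupp f -> m' != m -> lt m' m.

Definition initial_monomials lt A f : Prop :=
  exists g m, [/\ A g, is_initial lt g m & f = 'X_[m]].

Definition initial_ideal lt A : R -> Prop :=
  ideal_span (initial_monomials lt A).

Definition groebner_basis lt J G : Prop :=
  (forall g, g \in G -> J g /\ g != 0) /\
  forall f, initial_ideal lt J f <-> initial_ideal lt (fun g => g \in G) f.

Definition reduced_groebner_basis lt J G : Prop :=
  [/\ groebner_basis lt J G,
      forall g m, g \in G -> is_initial lt g m -> g@_m = 1 &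
      forall g h m m', g \in G -> h \in G -> g != h ->
        is_initial lt g m -> m' \in msupp h -> ~~ (m <= m')%MM].

End Groebner.

(* Lexicographic order induced by the order of the variables in which
   gt i j means 'X_i > 'X_j. *)
Definition lex_lt k (gt : rel 'I_k) (m1 m2 : 'X_{1..k}) : bool :=
  [exists i, (m1 i < m2 i)%N && [forall j, gt j i ==> (m1 j == m2 j)]].

Definition mon_left k l (m : 'X_{1..k + l}) : 'X_{1..k} :=
  [multinom m (lshift l i) | i < k].

Definition mon_right k l (m : 'X_{1..k + l}) : 'X_{1..l} :=
  [multinom m (rshift k i) | i < l].

Definition product_lt k l (ltl : rel 'X_{1..k}) (ltr : rel 'X_{1..l})
    (m1 m2 : 'X_{1..k + l}) : bool :=
  ltl (mon_left m1) (mon_left m2) ||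
  (mon_left m1 == mon_left m2) && ltr (mon_right m1) (mon_right m2).

(* zlt a b means z_a < z_b. *)
Definition rank_order d (T : finPOrderType d) (zlt : rel T) : Prop :=
  [/\ irreflexive zlt, transitive zlt,
      forall a b, a != b -> zlt a b || zlt b a &
      forall a b, (rank a < rank b)%N -> zlt a b].

Section Rees.
Context {K : fieldType} {d : Order.disp_t} {L : finMeetSemilatticeType d}.
Context {n : nat} (p : 'I_n -> jirr L).
Implicit Types a b c : L.

(* In S the variable x_i has index i and y_i has index n + i; in R the variable
   z_a comes after these and has index n + n + enum_rank a. *)
Local Notation S := {mpoly K[n + n]}.
Local Notation R := {mpoly K[(n + n) + #|L|]}.

Definition u a : S :=
  \prod_(i < n | p i \in val (embed a)) 'X_(lshift n i) *
  \prod_(i < n | p i \notin val (embed a)) 'X_(rshift n i).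

(* R -> S[t], whose image is the Rees algebra S[u_a t]. *)
Definition phi : R -> {poly S} :=
  mmap (polyC \o @mpolyC (n + n) K)
    (fun v => match split v with
              | inl i => ('X_i : S)%:P
              | inr j => (u (enum_val j))%:P * 'X
              end).

Definition J_ideal (f : R) : Prop := phi f = 0.

Definition x_ (i : 'I_n) : R := 'X_(lshift #|L| (lshift n i)).
Definition y_ (i : 'I_n) : R := 'X_(lshift #|L| (rshift n i)).
Definition z_ (a : L) : R := 'X_(rshift (n + n) (enum_rank a)).

Definition lex1 (zlt : rel L) : rel 'X_{1..(n + n) + #|L|} :=
  product_lt
    (lex_lt (fun i j : 'I_(n + n) => (i < j)%N))
    (lex_lt (fun i j : 'I_#|L| => zlt (enum_val j) (enum_val i))).

Definition hibi_binomial a b c : R := z_ a * z_ b - z_ (a `&` b)%O * z_ c.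

Definition hibi_relation (f : R) : Prop :=
  exists a b c, [/\ (a >< b)%O, is_join a b c &
    f = hibi_binomial a b c \/ f = - hibi_binomial a b c].

Definition special_linear_relation (f : R) : Prop :=
  exists a1 a2 i,
    [/\ p i \notin val (embed a1), val (embed a2) = p i |: val (embed a1) &
        f = x_ i * z_ a1 - y_ i * z_ a2].

End Rees.

(* Main.v *)
(** Put [P := jirr L].  If [hat L] is URC, then [P] has no antichain of three
    elements and the elements below any [p] have at most one maximal element.
    In a meet-distributive [L], a lower cover of [y] misses exactly one
    join-irreducible below [y]; with width at most two this makes the image of [L]
    a down-set of [hat L], so [L = hat L] as soon as [L] has a top element.

    If [a <> b] are both maximal in [L], the binomial
    [z_a x^(b\a) y^(a\b) - z_b x^(a\b) y^(b\a)] lies in [J_L].  Being linear in the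
    [z]'s, its initial monomial could only be divisible by the initial monomial
    [x_i z_c] of a special linear relation, which would yield an element of [L]
    above [a] or [b].

    Conversely, [J_L] is toric, so besides its initial monomial [m] every [f] in [J_L]
    contains a smaller monomial [m'] with the same image as [m] under [phi].  If the
    [S]-parts differ, a minimal [p_i] whose [x_i]-exponent is larger in [m] yields
    some [x_i z_a] dividing [m].  Otherwise let [z_c] be the first variable where they
    differ: counting the factors of [m] and [m'] above [c] by inclusion-exclusion
    over the at most two maximal elements of [c] yields some [z_a z_c] dividing [m]
    with [[a, c]] not a chain, which is the initial monomial of a Hibi relation. *)

From Pilot Require Import Defs.
From mathcomp Require Import all_boot all_order all_algebra.
From mathcomp.multinomials Require Import mpoly.

Set Implicit Arguments.
Unset Strict Implicit.
Unset Printing Implicit Defensive.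

Import Order.TTheory GRing.Theory.
Import Order.DefaultSetSubsetOrder.
(* [Order.TTheory] also exports a [lex1]. *)
Import Pilot.Defs.

Local Open Scope order_scope.

(** * Finite posets and meet-semilattices *)

Section FinitePosets.
Context {d : Order.disp_t} {T : finPOrderType d}.
Implicit Types (x y z : T) (Q : pred T).

Lemma minimal_below Q x : Q x ->
  exists2 y, Q y & y <= x /\ forall z, z < y -> ~~ Q z.
Proof.
have [k] := ubnP #|[pred z | z < x]|; elim: k x => // k IHk x; rewrite ltnS => ltk Qx.
case: (pickP [pred z | (z < x) && Q z]) => [z /andP[zx Qz] | none].
  have [|y Qy [yz miny]] := IHk z _ Qz.
    apply: leq_trans (proper_card _) ltk; apply/properP; split.
      by apply/subsetP=> w; rewrite !inE => wz; apply: lt_trans zx.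
    by exists z; rewrite ?inE ?ltxx.
  by exists y => //; split=> //; apply: le_trans (ltW zx).
by exists x => //; split=> // z zx; have := none z; rewrite /= zx => /= ->.
Qed.

Lemma maximal_above Q x : Q x ->
  exists2 y, Q y & x <= y /\ forall z, y < z -> ~~ Q z.
Proof.
have [k] := ubnP #|[pred z | x < z]|; elim: k x => // k IHk x; rewrite ltnS => ltk Qx.
case: (pickP [pred z | (x < z) && Q z]) => [z /andP[xz Qz] | none].
  have [|y Qy [zy maxy]] := IHk z _ Qz.
    apply: leq_trans (proper_card _) ltk; apply/properP; split.
      by apply/subsetP=> w; rewrite !inE => zw; apply: lt_trans zw.
    by exists z; rewrite ?inE ?ltxx.
  by exists y => //; split=> //; apply: le_trans zy; apply: ltW.
by exists x => //; split=> // z zx; have := none z; rewrite /= zx => /= ->.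
Qed.

Lemma coversP y z :
  reflect (z < y /\ forall w, z < w -> w < y -> False) (covers y z).
Proof.
apply: (iffP andP) => [[zy /forallP H]|[zy H]]; split=> //.
  by move=> w zw wy; have := H w; rewrite zw wy.
by apply/forallP=> w; apply/negP=> /andP[]; apply: H.
Qed.

Lemma covers_max y z w : covers y z -> z <= w -> w < y -> w = z.
Proof.
case/coversP=> zy H zw wy; apply/eqP; apply: contraT => wz.
by case: (H w) => //; rewrite lt_neqAle eq_sym wz.
Qed.

Lemma covered_above x y : x < y -> exists2 c, covers y c & x <= c.
Proof.
move=> xy; case: (@maximal_above [pred z | z < y] x xy) => c /= cy [xc maxc].
exists c => //; apply/coversP; split=> // w cw wy.
by have := maxc w cw; rewrite wy.
Qed.

Lemma rank_lt x y : x < y -> (rank x < rank y)%N.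
Proof.
move=> xy; rewrite {1}/rank.
(* The singleton shows that the maximum defining [rank x] ranges over a nonempty family, so a
   longest chain [C] attains it; [y |: C] is then a longer chain ending at [y]. *)
have chain1 : [&& x \in [set x], [forall z in [set x], z <= x]
    & is_chain (mem [set x])].
  rewrite set11 /=; apply/andP; split.
    by apply/forall_inP=> z; rewrite inE => /eqP->.
  apply/forallP=> u; apply/forallP=> v; rewrite !inE.
  by apply/implyP=> /eqP->; apply/implyP=> /eqP->; rewrite comparablexx.
rewrite (bigop.bigmax_eq_arg [set x]) //; case: arg_maxnP => //= C.
case/and3P=> xC /forall_inP Cx /forallP chC _.
have yC : y \notin C by apply/negP=> /Cx yx; have := lt_le_trans xy yx; rewrite ltxx.
have chainyC : [&& y \in y |: C, [forall z in y |: C, z <= y]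
    & is_chain (mem (y |: C))].
  rewrite setU11 /=; apply/andP; split.
    apply/forall_inP=> z; rewrite !inE => /predU1P[->//|/Cx zx].
    by rewrite (le_trans zx) ?ltW.
  apply/forallP=> u; apply/forallP=> v; rewrite !inE.
  apply/implyP=> /predU1P[-> | uC]; apply/implyP=> /predU1P[-> | vC].
  - exact: comparablexx.
  - by rewrite ge_comparable // (le_trans (Cx _ vC)) ?ltW.
  - by rewrite le_comparable // (le_trans (Cx _ uC)) ?ltW.
  - by have /forallP/(_ v) := chC u; rewrite /= uC vC.
apply: leq_trans (leq_bigmax_cond (y |: C) chainyC).
by rewrite cardsU1 yC add1n /= prednK // card_gt0; apply/set0Pn; exists x.
Qed.

End FinitePosets.

Section MeetSemilattices.
Context {d : Order.disp_t} {L : finMeetSemilatticeType d}.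
Implicit Types (x y z : L) (q r : jirr L).

Lemma jirr_not_min q : exists x, ~~ (val q <= x).
Proof. by case: q => q /= /andP[/existsP]. Qed.

Lemma jirr_join q x y : is_join x y (val q) -> val q = x \/ val q = y.
Proof.
case: q => q /= /andP[_ /forallP/(_ x)/forallP/(_ y)/implyP irr] /irr.
by case/orP=> /eqP; [left | right].
Qed.

Lemma is_joinP x y z :
  reflect (forall e, (z <= e) = (x <= e) && (y <= e)) (is_join x y z).
Proof. by apply: (iffP forallP) => H e; apply/eqP. Qed.

(** Two distinct lower covers would have [q] as their join: if a common upper bound [e] were not
    above [q], then [e] met with [q] would lie strictly below [q] and above both covers, hence equal
    both. *)
Lemma jirr_covers_uniq q c c' : covers (val q) c -> covers (val q) c' -> c = c'.
Proof.
move=> cov cov'; apply/eqP; apply: contraT => neq.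
have [lt _] := coversP _ _ cov; have [lt' _] := coversP _ _ cov'.
suff /jirr_join[E|E] : is_join c c' (val q).
- by rewrite E ltxx in lt.
- by rewrite E ltxx in lt'.
apply/is_joinP=> e; apply/idP/andP => [qe | [ce c'e]].
  by split; apply: ltW; [apply: lt_le_trans lt qe | apply: lt_le_trans lt' qe].
apply: contraT => nqe; have mlt : e `&` val q < val q.
  by rewrite lt_neqAle leIr andbT; apply: contra nqe => /eqP<-; rewrite leIl.
have E : e `&` val q = c by apply: (covers_max cov); rewrite // lexI ce ltW.
have E' : e `&` val q = c' by apply: (covers_max cov'); rewrite // lexI c'e ltW.
by rewrite -E E' eqxx in neq.
Qed.

(** A minimal [w] below [x] but not below [y] is join-irreducible, because everything strictly below
    [w] is below [y], and so is any join of two such elements. *)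
Lemma jirr_below_separates x y : ~~ (x <= y) ->
  exists2 q : jirr L, val q <= x & ~~ (val q <= y).
Proof.
move=> nxy.
have [|w /= /andP[wx nwy] [_ minw]] :=
  @minimal_below _ _ [pred w | (w <= x) && ~~ (w <= y)] x; first by rewrite /= lexx.
have below z : z < w -> z <= y.
  by move=> zw; have /= := minw z zw; rewrite (ltW (lt_le_trans zw wx)) negbK.
suff wirr : join_irreducible w by exists (exist _ w wirr).
apply/andP; split; first by apply/existsP; exists y.
apply/forallP=> u; apply/forallP=> v; apply/implyP=> /is_joinP join_uv.
apply: contraT; rewrite negb_or => /andP[nu nv].
case/negP: nwy; have := join_uv w; rewrite lexx => /esym/andP[uw vw].
by rewrite join_uv !below // lt_neqAle eq_sym ?nu ?nv.
Qed.

Lemma jirr_below_subset x y : (jirr_below x \subset jirr_below y) = (x <= y).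
Proof.
apply/subsetP/idP => [sub | xy q]; last by rewrite !inE => /le_trans; apply.
apply: contraT => /jirr_below_separates[q qx /negP[]].
by have := sub q; rewrite !inE; apply.
Qed.

Lemma jirr_below_inj : injective (@jirr_below d L).
Proof.
by move=> x y E; apply/eqP; rewrite eq_le -!jirr_below_subset E subxx.
Qed.

Lemma jirr_belowI x y : jirr_below (x `&` y) = jirr_below x :&: jirr_below y.
Proof. by apply/setP=> q; rewrite !inE lexI. Qed.

(** The second hypothesis excludes the bottom, so [y] is a join of two elements different from [y].
    A single lower cover above both of them would be above [y]. *)
Lemma not_jirr_covers y : ~~ join_irreducible y -> (exists x, ~~ (y <= x)) ->
  exists c c', [/\ covers y c, covers y c' & c != c'].
Proof.
move=> nirr /existsP nmin; move: nirr; rewrite /join_irreducible nmin /=.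
rewrite negb_forall => /existsP[u]; rewrite negb_forall => /existsP[v].
rewrite negb_imply negb_or => /andP[/is_joinP join_uv /andP[nu nv]].
have := join_uv y; rewrite lexx => /esym/andP[uy vy].
have [|c cov uc] := @covered_above _ _ u y; first by rewrite lt_neqAle eq_sym nu.
have [|c' cov' vc'] := @covered_above _ _ v y; first by rewrite lt_neqAle eq_sym nv.
exists c, c'; split=> //; apply/eqP=> E; move: vc'; rewrite -E => vc.
have := join_uv c; rewrite uc vc => yc.
by have [cy _] := coversP _ _ cov; have := lt_le_trans cy yc; rewrite ltxx.
Qed.

Lemma bigmeet_le_idx (P : pred L) y (s : seq L) :
  \big[Order.meet/y]_(z <- s | P z) z <= y.
Proof.
elim: s => [|z s IH]; rewrite ?big_nil ?big_cons //.
by case: ifP => // _; apply: le_trans IH; apply: leIr.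
Qed.

Lemma bigmeet_le (P : pred L) y z (s : seq L) : z \in s -> P z ->
  \big[Order.meet/y]_(w <- s | P w) w <= z.
Proof.
elim: s => // w s IH; rewrite big_cons inE => /predU1P[<- Pz | zs Pz].
  by rewrite Pz leIl.
by case: ifP => _; [apply: le_trans (leIr _ _) _ |]; apply: IH.
Qed.

End MeetSemilattices.

(** * Meet-distributive semilattices *)

Section MeetDistributive.
Context {d : Order.disp_t} {L : finMeetSemilatticeType d}.
Hypothesis L_md : meet_distributive L.
Implicit Types (x y z c : L) (q r : jirr L).

(** With [x] the meet of all lower covers of [y], every lower cover lies in [[x, y]], so [x] is also
    the meet of those inside the interval, as [meet_distributive] requires. *)
Lemma lower_covers_boolean y : exists2 x,
  boolean_itv x y & forall c, covers y c -> x <= c.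
Proof.
pose x := \big[Order.meet/y]_(z | covers y z) z.
have xc c : covers y c -> x <= c.
  by move=> cov; apply: bigmeet_le => //; apply: mem_index_enum.
exists x => //; apply: L_md; first exact: bigmeet_le_idx.
apply: eq_bigl => z; rewrite andb_idl // => cov.
by rewrite /itv xc //= ltW //; case/coversP: cov.
Qed.

(** A lower cover corresponds to a proper subset, which omits some [i]; by maximality it is the
    whole complement of [i]. *)
Lemma boolean_coatoms n (f : {set 'I_n} -> L) x y :
    (forall A B, (f A <= f B) = (A \subset B)) ->
    (forall z, itv x y z <-> exists A, f A = z) ->
  y = f setT /\ forall c, covers y c -> x <= c -> exists i, c = f (~: [set i]).
Proof.
move=> fle fitv.
have xf A : x <= f A by have /fitv/andP[] : exists B, f B = f A by exists A.
have fy A : f A <= y by have /fitv/andP[] : exists B, f B = f A by exists A.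
have /fitv[Y fY] : itv x y y by rewrite /itv lexx (le_trans (xf set0)).
have yT : y = f setT by apply/eqP; rewrite eq_le fy -fY fle subsetT.
split=> // c cov xc; have [cy _] := coversP _ _ cov.
have /fitv[C fC] : itv x y c by rewrite /itv xc ltW.
have /subsetPn[i _ iC] : ~~ ([set: 'I_n] \subset C).
  by rewrite -fle -yT fC lt_geF.
exists i; apply/esym/(covers_max cov).
  by rewrite -fC fle; apply/subsetP=> j jC; rewrite !inE; apply: contraNneq iC => <-.
rewrite yT lt_neqAle fle subsetT andbT; apply/eqP=> E.
have : setT \subset ~: [set i] by rewrite -fle E.
by move/subsetP/(_ i (in_setT i)); rewrite !inE eqxx.
Qed.

Lemma covers_meet y c c' : covers y c -> covers y c' -> c != c' ->
  covers c' (c `&` c').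
Proof.
move=> cov cov' neq.
have [x [n [f [fle fitv]]] xcov] := lower_covers_boolean y.
have [yT coat] := boolean_coatoms fle fitv.
have [i ci] := coat _ cov (xcov _ cov); have [j c'j] := coat _ cov' (xcov _ cov').
have ij : i != j by apply: contraNneq neq => ij; rewrite ci c'j ij.
have cc'_lt : c `&` c' < c'.
  rewrite lt_neqAle leIr andbT; apply: contraNneq ij => E.
  have : c' <= c by rewrite -E leIl.
  rewrite ci c'j fle => /subsetP/(_ i); rewrite !inE eqxx.
  by case: (i == j) => // /(_ isT).
apply/coversP; split=> // w mw wc'.
have /fitv[W fW] : itv x y w.
  rewrite /itv (le_trans _ (ltW mw)) ?lexI ?xcov //.
  by apply: le_trans (ltW wc') _; case/coversP: cov' => /ltW.
have prW : W \proper ~: [set j].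
  rewrite properEneq -fle fW -c'j (ltW wc') andbT.
  by apply: contraTneq wc' => E; rewrite -fW E -c'j ltxx.
have jW : j \notin W.
  by apply/negP=> jW; case/andP: prW => /subsetP/(_ j jW); rewrite !inE eqxx.
have Wm : W \subset ~: [set i] -> w <= c `&` c'.
  by move=> Wi; rewrite lexI -fW ci c'j !fle Wi; case/andP: prW.
(* If [W] contained [i], it would be all of [~: [set j]], since it contains [V] and [V] contains
   everything except possibly [i] and [j]. This contradicts [prW]. *)
have /Wm : W \subset ~: [set i]; last by rewrite lt_geF.
have /fitv[V fV] : itv x y (c `&` c').
  rewrite /itv lexI !xcov //= (le_trans (leIl _ _)) //.
  by case/coversP: cov => /ltW.
apply/subsetP=> l lW; rewrite !inE; apply: contraTneq prW => li.
rewrite /proper negb_and negbK; apply/orP; right.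
have sub : ~: [set i; j] \subset V.
  have : f (~: [set i; j]) <= c `&` c'.
    by rewrite lexI ci c'j !fle !setCS !sub1set !inE !eqxx orbT.
  by rewrite -fV fle.
apply/subsetP=> m; rewrite !inE => mj.
have [->|mi] := eqVneq m i; first by rewrite -li.
have /subsetP : V \subset W by rewrite -fle fV fW ltW.
by apply; apply: (subsetP sub); rewrite !inE negb_or mi.
Qed.

Lemma covers_meet_nle y c c' c'' : covers y c -> covers y c' -> covers y c'' ->
  c != c' -> c != c'' -> ~~ (c' `&` c'' <= c).
Proof.
move=> cov cov' cov'' neq' neq''.
have [x [n [f [fle fitv]]] xcov] := lower_covers_boolean y.
have [yT coat] := boolean_coatoms fle fitv.
have [i ci] := coat _ cov (xcov _ cov); have [j c'j] := coat _ cov' (xcov _ cov').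
have [l c''l] := coat _ cov'' (xcov _ cov'').
have ij : i != j by apply: contraNneq neq' => ij; rewrite ci c'j ij.
have il : i != l by apply: contraNneq neq'' => il; rewrite ci c''l il.
apply/negP=> le; have : f (~: [set j; l]) <= f (~: [set i]).
  by rewrite -ci (le_trans _ le) // lexI c'j c''l !fle !setCS !sub1set !inE !eqxx orbT.
rewrite fle => /subsetP/(_ i); by rewrite !inE eqxx negb_or ij il => /(_ isT).
Qed.

(** Induction on the number of elements below [y]. If [q] and [q'] lie below lower covers [c'] and
    [c''], some [r] below both of these is not below [c]. Induction in [c'] over its meet with [c]
    gives [q = r], and in [c''] it gives [r = q']. *)
Lemma covers_misses_one y c q q' : covers y c ->
  val q <= y -> val q' <= y -> ~~ (val q <= c) -> ~~ (val q' <= c) -> q = q'.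
Proof.
have [k] := ubnP #|[pred z | z < y]|; elim: k y c q q' => // k IHk y c q q'.
rewrite ltnS => ltk cov qy q'y nq nq'.
have IH y' c0 r r' : y' < y -> covers y' c0 -> val r <= y' -> val r' <= y' ->
    ~~ (val r <= c0) -> ~~ (val r' <= c0) -> r = r'.
  move=> y'y; apply: IHk; apply: leq_trans (proper_card _) ltk.
  apply/properP; split; last by exists y'; rewrite ?inE ?ltxx.
  by apply/subsetP=> w; rewrite !inE => wy'; apply: lt_trans y'y.
(* If [y] itself is join-irreducible, [c] is its only lower cover, so everything strictly below [y]
   is below [c]. *)
have top r r' : val r = y -> val r' <= y -> ~~ (val r' <= c) -> r = r'.
  move=> ry r'y nr'; apply: val_inj; rewrite ry; apply/esym/eqP.
  apply: contraT => neq; have [|c' cov'] := @covered_above _ _ (val r') y.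
    by rewrite lt_neqAle neq.
  have E : c = c' by apply: (@jirr_covers_uniq _ _ r); rewrite ry.
  by rewrite -E (negPf nr').
have [/eqP Eq|qlt] := boolP (val q == y); first exact: top.
have [/eqP Eq'|q'lt] := boolP (val q' == y); first by apply/esym/top.
have [|c' cov' qc'] := @covered_above _ _ (val q) y; first by rewrite lt_neqAle qlt.
have [|c'' cov'' q'c''] := @covered_above _ _ (val q') y; first by rewrite lt_neqAle q'lt.
have ncc' : c != c' by apply: contraNneq nq => ->.
have ncc'' : c != c'' by apply: contraNneq nq' => ->.
have [r] := jirr_below_separates (covers_meet_nle cov cov' cov'' ncc' ncc'').
rewrite lexI => /andP[rc' rc''] nr.
have [[lt' _] [lt'' _]] := (coversP _ _ cov', coversP _ _ cov'').
transitivity r.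
  apply: (IH c' (c `&` c')) => //; first exact: covers_meet cov' ncc'.
    by rewrite lexI negb_and nq.
  by rewrite lexI negb_and nr.
apply: (IH c'' (c `&` c'')) => //; first exact: covers_meet cov'' ncc''.
  by rewrite lexI negb_and nr.
by rewrite lexI negb_and nq'.
Qed.

Lemma jirr_below_covers y c : covers y c ->
  exists2 q, q \in jirr_below y & jirr_below c = jirr_below y :\ q.
Proof.
move=> cov; have [cy _] := coversP _ _ cov.
have [|q qy nqc] := @jirr_below_separates _ _ y c; first by rewrite lt_geF.
exists q; first by rewrite inE.
apply/setP=> r; rewrite !inE; apply/idP/andP => [rc | [nrq ry]].
  by split; [apply: contraNneq nqc => <- | apply: le_trans rc (ltW cy)].
by apply: contraNT nrq => nrc; apply/eqP/(covers_misses_one cov).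
Qed.

End MeetDistributive.
(** * Uniquely relatively complemented ideal lattices *)

(** The incomparable pair rules out the chain alternative. A member of the complementary set equal
    to [b] would force the other one to be [a], which [complementary_set] forbids. *)
Lemma URC_complement d (T : finLatticeType d) (a b x y : T) : URC T ->
    a <= x -> x <= b -> a <= y -> y <= b -> x >< y ->
  exists c e, [/\ c `|` e = b, c `&` e = a, c != b & e != b].
Proof.
move=> urc ax xb ay yb nxy; case: (urc a b) => [||[C [[c [e [CE itvs ceb cea neqab]]] _]]].
- exact: le_trans ax xb.
- move/forallP/(_ x)/forallP/(_ y); rewrite /itv ax xb ay yb /=.
  by rewrite (negPf nxy).
move: itvs neqab; rewrite CE /itv => /andP[/andP[ac cb] /andP[ae eb]] neqab.
exists c, e; split=> //; apply: contra neqab => /eqP E.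
- by rewrite -cea E meet_r // setUC.
- by rewrite -cea E meet_l.
Qed.

Lemma URC_complement_unique d (T : finLatticeType d) (a b c e : T) : URC T ->
    a >< b -> c >< e -> a `&` b = c `&` e -> a `|` b = c `|` e ->
  [set a; b] = [set c; e].
Proof.
move=> urc nab nce Emeet Ejoin.
have compl (x y : T) : x >< y -> complementary_set (x `&` y) (x `|` y) [set x; y].
  move=> nxy; exists x, y; split=> //.
    by rewrite /itv !leIl !leIr !leUl !leUr.
  apply: contraNneq nxy => E; have : x `&` y \in [set x; y] by rewrite E set21.
  rewrite /Order.comparable => /set2P[] E'; apply/orP; [left | right].
    by rewrite -E' leIr.
  by rewrite -E' leIl.
have [||[C [_ uniqC]]] := urc (a `&` b) (a `|` b).
- exact: le_trans (leIl _ _) (leUl _ _).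
- move/forallP/(_ a)/forallP/(_ b).
  by rewrite /itv leIl leIr leUl leUr /= (negPf nab).
rewrite -(uniqC _ (compl a b nab)); apply: uniqC.
by rewrite Emeet Ejoin; apply: compl.
Qed.

Section URCIdealLattice.
Context {d : Order.disp_t} {P : finPOrderType d}.
Implicit Types (I J : ideal_lattice P) (q r x y : P) (S : {set P}).

Definition mk_ideal (A : {set P}) (idealA : poset_ideal A) : ideal_lattice P :=
  exist _ A idealA.

Lemma ideal_le I J : (I <= J) = (val I \subset val J).
Proof. by rewrite leEsub. Qed.

Lemma ideal_join I J : val (I `|` J) = val I :|: val J.
Proof. by []. Qed.

Lemma ideal_meet I J : val (I `&` J) = val I :&: val J.
Proof. by []. Qed.

Lemma ideal_closed I x y : x \in val I -> y <= x -> y \in val I.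
Proof. by case: I => I /= /poset_idealP H; apply: H. Qed.

Section Antichain.
Variable Q : {set P}.
Hypothesis antichainQ : {in Q &, forall q r, ~~ (q < r)}.

Let below := [set x | [exists q in Q, x < q]].

Fact above_antichain_subproof S : poset_ideal ((S :&: Q) :|: below).
Proof.
apply/poset_idealP=> x y; rewrite !inE => /orP[/andP[xS xQ] | /exists_inP[q qQ xq]] yx.
  have [->|yneq] := eqVneq y x; first by rewrite xS xQ.
  by apply/orP; right; apply/exists_inP; exists x; rewrite // lt_neqAle yneq.
by apply/orP; right; apply/exists_inP; exists q; rewrite // (le_lt_trans yx).
Qed.

(** The ideals between [below] and its union with [Q] form a copy of the Boolean lattice of subsets
    of the antichain [Q]. Intersecting with [Q] allows an arbitrary [S]. *)
Definition above_antichain S : ideal_lattice P :=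
  mk_ideal (above_antichain_subproof S).

Lemma above_antichain_le S S' :
  (above_antichain S <= above_antichain S') = (S :&: Q \subset S').
Proof.
rewrite ideal_le; apply/idP/idP => [/subsetP le | le]; last first.
  by apply: setSU; rewrite subsetI le subsetIr.
apply/subsetP=> x; rewrite !inE => /andP[xS xQ].
have := le x; rewrite !inE xS xQ /= => /(_ isT)/orP[/andP[]//|/exists_inP[q qQ xq]].
by have := antichainQ xQ qQ; rewrite xq.
Qed.

Lemma above_antichain_eq S S' : S \subset Q -> S' \subset Q ->
  above_antichain S = above_antichain S' -> S = S'.
Proof.
move=> SQ S'Q /eqP; rewrite eq_le !above_antichain_le.
by rewrite (setIidPl SQ) (setIidPl S'Q) -eqEsubset => /eqP.
Qed.

Lemma above_antichain_itv S :
  itv (above_antichain set0) (above_antichain Q) (above_antichain S).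
Proof. by rewrite /itv !above_antichain_le set0I sub0set subsetIr. Qed.

Lemma above_antichain_complementary S : S \subset Q -> S != set0 -> S != Q ->
  complementary_set (above_antichain set0) (above_antichain Q)
    [set above_antichain S; above_antichain (Q :\: S)].
Proof.
move=> SQ S0 SQ'; exists (above_antichain S), (above_antichain (Q :\: S)).
split=> //; first by rewrite !above_antichain_itv.
- apply: val_inj; rewrite ideal_join /= setUACA setUid -setIUl; congr (_ :&: _ :|: _).
  by rewrite -{1}(setIidPr SQ) setID.
- apply: val_inj; rewrite ideal_meet /= -setUIl; congr (_ :|: _).
  by apply/setP=> x; rewrite !inE; case: (x \in S); rewrite ?andbF.
apply: contra_neqN S0 => /eqP E.
have : above_antichain S \in [set above_antichain set0; above_antichain Q].
  by rewrite -E set21.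
case/set2P=> /above_antichain_eq; [by apply; rewrite // sub0set|].
by move=> EQ; rewrite EQ ?subxx ?eqxx // in SQ'.
Qed.

End Antichain.

Hypothesis urc : URC (ideal_lattice P).

(** A three-element antichain yields a Boolean interval of rank three, in which [{q1}] and [{q2}],
    each with its complement, are two different complementary sets. *)
Lemma URC_no_antichain3 q1 q2 q3 : q1 >< q2 -> q1 >< q3 -> q2 >< q3 -> False.
Proof.
move=> n12 n13 n23; pose Q := [set q1; q2; q3].
have d12 : q1 != q2 by apply: contraNneq n12 => ->; apply: comparablexx.
have d13 : q1 != q3 by apply: contraNneq n13 => ->; apply: comparablexx.
have d23 : q2 != q3 by apply: contraNneq n23 => ->; apply: comparablexx.
have antiQ : {in Q &, forall q r, ~~ (q < r)}.
  have nlt q r : q >< r -> (q < r = false) * (r < q = false).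
    by rewrite /Order.comparable negb_or => /andP[nqr nrq];
       split; apply: contraTF isT => lt; rewrite (ltW lt) in nqr nrq.
  move=> q r; rewrite !inE -!orbA.
  by move=> /or3P[]/eqP-> /or3P[]/eqP->;
    rewrite ?ltxx ?(nlt _ _ n12) ?(nlt _ _ n13) ?(nlt _ _ n23).
have q1Q : [set q1] \subset Q by rewrite sub1set !inE eqxx.
have q2Q : [set q2] \subset Q by rewrite sub1set !inE eqxx orbT.
have compl q : q \in Q -> [set q] != Q ->
    complementary_set (above_antichain Q set0) (above_antichain Q Q)
      [set above_antichain Q [set q]; above_antichain Q (Q :\ q)].
  move=> qQ neq; apply: above_antichain_complementary => //.
    by rewrite sub1set.
  by apply/set0Pn; exists q; rewrite inE.
have n1 : [set q1] != Q.
  by apply/eqP=> /setP/(_ q2); rewrite !inE eqxx orbT eq_sym (negPf d12).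
have n2 : [set q2] != Q.
  by apply/eqP=> /setP/(_ q1); rewrite !inE eqxx (negPf d12).
have [] := urc (_ : above_antichain Q set0 <= above_antichain Q Q).
- by rewrite above_antichain_le // set0I sub0set.
- move=> /forallP/(_ (above_antichain Q [set q1]))/forallP/(_ (above_antichain Q [set q2])).
  rewrite !above_antichain_itv //= /Order.comparable !above_antichain_le //.
  by rewrite (setIidPl q1Q) (setIidPl q2Q) !sub1set !inE (eq_sym q2) (negPf d12).
case=> C [_ uniqC].
have E : [set above_antichain Q [set q1]; above_antichain Q (Q :\ q1)] =
         [set above_antichain Q [set q2]; above_antichain Q (Q :\ q2)].
  by rewrite -(uniqC _ (compl q1 _ n1)) -?(uniqC _ (compl q2 _ n2)) ?inE ?eqxx ?orbT.
have : above_antichain Q [set q1] \in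
    [set above_antichain Q [set q2]; above_antichain Q (Q :\ q2)].
  by rewrite -E set21.
case/set2P=> /above_antichain_eq => /(_ antiQ)-/(_ q1Q).
  by move/(_ q2Q)/setP/(_ q1); rewrite !inE eqxx (negPf d12).
(* In the remaining case [{q1}] would equal [Q :\ q2], which also contains [q3]. *)
move/(_ (subsetDl _ _))/setP/(_ q3).
by rewrite !inE eqxx orbT (eq_sym q3) (negPf d13) (eq_sym q3) d23.
Qed.

(** If [r] and [r'] differ, the interval from the elements strictly below [p] without [r] and [r']
    up to the principal ideal of [p] is not a chain, so its top is a join of two proper ideals. One
    of them contains [p] and is therefore the whole top, a contradiction. *)
Lemma URC_lower_max_uniq p r r' : r < p -> r' < p ->
    (forall q, r < q -> ~~ (q < p)) -> (forall q, r' < q -> ~~ (q < p)) ->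
  r = r'.
Proof.
move=> rp r'p maxr maxr'; apply/eqP; apply: contraT => neq.
have ideal_del S : (forall q x, q \in S -> q < x -> ~~ (x < p)) ->
    poset_ideal ([set x | x < p] :\: S).
  move=> maxS; apply/poset_idealP=> x y; rewrite !inE => /andP[xS xp] yx.
  rewrite (le_lt_trans yx xp) andbT; apply: contraL xp => yS.
  have [E|neqx] := eqVneq y x; first by rewrite -E yS in xS.
  by apply: maxS yS _; rewrite lt_neqAle neqx.
have max1 s : (forall q, s < q -> ~~ (q < p)) ->
    forall q x, q \in [set s] -> q < x -> ~~ (x < p).
  by move=> H q x /set1P->; apply: H.
have max2 q x : q \in [set r; r'] -> q < x -> ~~ (x < p).
  by case/set2P=> ->; [apply: maxr | apply: maxr'].
have topi : poset_ideal [set x | x <= p].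
  by apply/poset_idealP=> x y; rewrite !inE => xp /le_trans; apply.
have [b bE] : exists b : ideal_lattice P, val b = [set x | x <= p].
  by exists (mk_ideal topi).
have [a aE] : exists a : ideal_lattice P, val a = [set x | x < p] :\: [set r; r'].
  by exists (mk_ideal (ideal_del _ max2)).
have [I1 I1E] : exists I1 : ideal_lattice P, val I1 = [set x | x < p] :\ r.
  by exists (mk_ideal (ideal_del _ (max1 _ maxr))).
have [I2 I2E] : exists I2 : ideal_lattice P, val I2 = [set x | x < p] :\ r'.
  by exists (mk_ideal (ideal_del _ (max1 _ maxr'))).
have leb (J : ideal_lattice P) S : val J = [set x | x < p] :\: S -> J <= b.
  move=> JE; rewrite ideal_le JE bE; apply: subset_trans (subsetDl _ _) _.
  by apply/subsetP=> x; rewrite !inE => /ltW.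
have aI1 : a <= I1 by rewrite ideal_le aE I1E setDS // sub1set set21.
have aI2 : a <= I2 by rewrite ideal_le aE I2E setDS // sub1set set22.
have I12 : I1 >< I2.
  rewrite /Order.comparable !ideal_le I1E I2E.
  by apply/negP=> /orP[/subsetP/(_ r') | /subsetP/(_ r)];
    rewrite !inE eqxx ?rp ?r'p ?(eq_sym r' r) ?neq => /(_ isT).
have [c [e [ceb _ cb eb]]] :=
  URC_complement urc aI1 (leb _ _ I1E) aI2 (leb _ _ I2E) I12.
have full (J : ideal_lattice P) : p \in val J -> J <= b -> J = b.
  move=> pJ Jb; apply/eqP; rewrite eq_le Jb ideal_le bE.
  by apply/subsetP=> x; rewrite inE; apply: ideal_closed pJ.
have : p \in val (c `|` e) by rewrite ceb bE inE lexx.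
rewrite ideal_join inE => /orP[pc|pe].
- by rewrite (full c) ?eqxx // -ceb leUl in cb.
- by rewrite (full e) ?eqxx // -ceb leUr in eb.
Qed.

Lemma URC_lower_max p :
  (forall q, ~~ (q < p)) \/ exists2 r, r < p & forall q, q < p -> q <= r.
Proof.
case: (pickP [pred q | q < p]) => [q qp | none]; last first.
  by left=> q; have /= -> := none q.
right; have [r /= rp [_ maxr]] := maximal_above qp.
exists r => // s sp; have [r' /= r'p [sr' maxr']] := @maximal_above _ _ [pred q | q < p] s sp.
by rewrite (URC_lower_max_uniq rp r'p).
Qed.

End URCIdealLattice.

(** * The image of the semilattice as a down-set of its ideal lattice *)

Section DownSet.
Context {d : Order.disp_t} {L : finMeetSemilatticeType d}.
Hypothesis L_md : meet_distributive L.
Hypothesis hatL_URC : URC (hat L).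
Implicit Types (a l : L) (q r : jirr L) (I : {set jirr L}).

Definition maximal_in I q := q \in I /\ forall r, r \in I -> ~~ (q < r).

Lemma maximal_in_incomparable I q r :
  maximal_in I q -> maximal_in I r -> q != r -> q >< r.
Proof.
case=> qI maxq [rI maxr] neq; rewrite /Order.comparable negb_or !le_eqVlt.
by rewrite (eq_sym r) (negPf neq) /= maxq ?maxr.
Qed.

Lemma covers_maximal_in a c q : jirr_below c = jirr_below a :\ q ->
  q \in jirr_below a -> maximal_in (jirr_below a) q.
Proof.
move=> E qa; split=> // r ra; apply/negP=> qr.
have rc : r \in jirr_below c.
  rewrite E in_setD1 ra andbT.
  by apply: contraTneq qr => ->; rewrite ltxx.
have : q \in jirr_below c by move: rc; rewrite !inE; apply: le_trans (ltW qr : val q <= val r).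
by rewrite E !inE eqxx.
Qed.

(** If [a] is join-irreducible, then [q] is [a] itself and every lower cover drops it. Otherwise two
    distinct lower covers drop distinct maximal elements [r] and [r']; [q] is one of them, or the
    three would be an antichain. *)
Lemma drop_maximal a q : maximal_in (jirr_below a) q ->
  exists l, jirr_below l = jirr_below a :\ q.
Proof.
move=> maxq; have [qa mq] := maxq.
(* This says that [a] is not the bottom; meeting [a] with [x] gives an element strictly below it,
   hence a lower cover. *)
have [x nax] : exists x, ~~ (a <= x).
  have [x nqx] := jirr_not_min q; exists x; apply: contra nqx.
  by apply: le_trans; rewrite inE in qa.
suff [c [r [E ra rq]]] : exists c r,
    [/\ jirr_below c = jirr_below a :\ r, r \in jirr_below a & r = q].
  by exists c; rewrite E rq.
have [airr | nairr] := boolP (join_irreducible a).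
  pose p : jirr L := exist _ a airr.
  have qp : q = p.
    apply/eqP; apply: contraT => neq.
    have /mq : p \in jirr_below a by rewrite inE.
    by rewrite lt_neqAle neq leEsub; move: qa; rewrite inE => ->.
  have [|c cov _] := @covered_above _ _ (a `&` x) a.
    by rewrite lt_neqAle leIl andbT; apply: contra nax => /eqP <-; apply: leIr.
  have [r ra E] := jirr_below_covers L_md cov; exists c, r; split=> //.
  apply/eqP; rewrite eq_sym; apply: contraT => neq.
  have : q \in jirr_below c by rewrite E !inE neq; rewrite inE in qa.
  by have [ca _] := coversP _ _ cov; rewrite inE qp /= lt_geF.
have [|c [c' [cov cov' neq]]] := not_jirr_covers nairr; first by exists x.
have [r ra E] := jirr_below_covers L_md cov.
have [r' r'a E'] := jirr_below_covers L_md cov'.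
have [Eq|nq] := eqVneq r q; first by exists c, r.
have [Eq'|nq'] := eqVneq r' q; first by exists c', r'.
have rr' : r != r'.
  by apply: contraNneq neq => Er; apply/eqP/jirr_below_inj; rewrite E E' Er.
have [mr mr'] := (covers_maximal_in E ra, covers_maximal_in E' r'a).
by have [] := URC_no_antichain3 hatL_URC (maximal_in_incomparable mr mr' rr')
  (maximal_in_incomparable mr maxq nq) (maximal_in_incomparable mr' maxq nq').
Qed.

(** The join-irreducibles outside [I] are removed one at a time. A maximal one among them is maximal
    in all of [jirr_below a], because [I] is down-closed, so [drop_maximal] applies. *)
Lemma jirr_below_down_closed a I : poset_ideal I -> I \subset jirr_below a ->
  exists l, jirr_below l = I.
Proof.
move/poset_idealP=> idI; have [k] := ubnP #|jirr_below a|.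
elim: k a => // k IHk a; rewrite ltnS => lek sub.
have [->|neq] := eqVneq I (jirr_below a); first by exists a.
have /subsetPn[q0 q0a q0I] : ~~ (jirr_below a \subset I).
  by apply: contra neq => sub'; rewrite eqEsubset sub.
have [|q /= /andP[qa qI] [_ maxq]] := @maximal_above _ _
  [pred q | (q \in jirr_below a) && (q \notin I)] q0; first by rewrite /= q0a.
have [|l E] := @drop_maximal a q.
  split=> // r ra; apply/negP=> qr; have /= := maxq _ qr.
  by rewrite ra negbK => rI; case/negP: qI; apply: idI rI (ltW qr).
apply: (IHk l); first by apply: leq_trans lek; rewrite E [ltnRHS](cardsD1 q) qa.
by rewrite E subsetD1 sub.
Qed.

End DownSet.
Local Open Scope ring_scope.

(** * Initial ideals and binomials *)

Section IdealSpans.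
Context {K : fieldType} {k : nat}.
Local Notation R := {mpoly K[k]}.
Implicit Types (lt : rel 'X_{1..k}) (f g : R) (A B J : R -> Prop) (G : seq R).

Lemma ideal_span_sub A f : A f -> ideal_span A f.
Proof.
move=> Af; exists [:: (1, f)]; split; last by rewrite big_seq1 mul1r.
by move=> q /[!inE] /eqP->.
Qed.

Lemma ideal_span_add A f g : ideal_span A f -> ideal_span A g ->
  ideal_span A (f + g).
Proof.
move=> [s [sA ->]] [t [tA ->]]; exists (s ++ t); split; last by rewrite big_cat.
by move=> q; rewrite mem_cat => /orP[/sA | /tA].
Qed.

Lemma ideal_span_mul A f g : ideal_span A f -> ideal_span A (g * f).
Proof.
move=> [s [sA ->]]; exists [seq (g * q.1, q.2) | q <- s]; split.
  by move=> _ /mapP[q qs ->] /=; apply: sA.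
by rewrite big_map mulr_sumr; apply: eq_bigr => q _; rewrite mulrA.
Qed.

Lemma ideal_span_min A B f : (forall g, A g -> ideal_span B g) ->
  ideal_span A f -> ideal_span B f.
Proof.
move=> AB [s [sA ->]]; elim: s sA => [|q s IHs] sA.
  by rewrite big_nil; exists [::]; split=> [q|]; rewrite ?in_nil ?big_nil.
rewrite big_cons; apply: ideal_span_add.
  by apply/ideal_span_mul/AB/sA/mem_head.
by apply: IHs => r rs; apply: sA; rewrite inE rs orbT.
Qed.

Lemma initial_ideal_sub lt A B f :
    (forall g m, A g -> is_initial lt g m ->
      exists h m', [/\ B h, is_initial lt h m' & (m' <= m)%MM]) ->
  initial_ideal lt A f -> initial_ideal lt B f.
Proof.
move=> AB; apply: ideal_span_min => _ [g [m [Ag gm ->]]].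
have [h [m' [Bh hm' m'm]]] := AB g m Ag gm.
rewrite -(submK m'm) mpolyXD; apply: ideal_span_mul; apply: ideal_span_sub.
by exists h, m'.
Qed.

(** The monomial has to occur in some summand, and every monomial of a multiple of ['X_[m']] is
    divisible by [m']. *)
Lemma monomial_in_initial_ideal lt A m : initial_ideal lt A 'X_[m] ->
  exists g m', [/\ A g, is_initial lt g m' & (m' <= m)%MM].
Proof.
move=> [s [sA Em]].
have /hasP[q qs] : has (fun q : R * R => (q.1 * q.2)@_m != 0) s.
  apply: contraT => /hasPn none; suff : ('X_[m] : R)@_m == 0.
    by rewrite mcoeffX eqxx oner_eq0.
  by rewrite Em raddf_sum big_seq big1 // => q /none; rewrite negbK => /eqP.
have [g [m' [Ag gm' ->]]] := sA q qs.
rewrite -mcoeff_msupp (perm_mem (msuppMX _ _)) => /mapP[w _ ->].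
by exists g, m'; split=> //; apply: lem_addr.
Qed.

Lemma groebner_basis_divides lt J G :
    (forall g, g \in G -> J g /\ g != 0) ->
    (forall f m, J f -> is_initial lt f m ->
      exists g m', [/\ g \in G, is_initial lt g m' & (m' <= m)%MM]) ->
  groebner_basis lt J G.
Proof.
move=> GJ div; split=> // f; split; apply: initial_ideal_sub => //.
by move=> g m gG gm; exists g, m; split; rewrite ?lepm_refl //; case: (GJ g gG).
Qed.

Section Binomials.
Variables (m1 m2 : 'X_{1..k}).
Hypothesis neq : m1 != m2.

Lemma mem_msupp_binomial m :
  (m \in msupp ('X_[m1] - 'X_[m2] : R)) = (m == m1) || (m == m2).
Proof.
rewrite mcoeff_msupp mcoeffB !mcoeffX (eq_sym m1) (eq_sym m2).
have [->|nm1] := eqVneq m m1; first by rewrite (negPf neq) subr0 oner_eq0.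
by case: (m == m2); rewrite ?subrr ?eqxx // sub0r oppr_eq0 oner_eq0.
Qed.

Lemma binomial_neq0 : 'X_[m1] - 'X_[m2] != 0 :> R.
Proof.
apply/eqP=> E; have := mem_msupp_binomial m1.
by rewrite E msupp0 eqxx.
Qed.

Lemma binomial_coeff : ('X_[m1] - 'X_[m2] : R)@_m1 = 1.
Proof. by rewrite mcoeffB !mcoeffX eqxx eq_sym (negPf neq) subr0. Qed.

Lemma binomial_is_initial lt : lt m2 m1 -> is_initial lt ('X_[m1] - 'X_[m2] : R) m1.
Proof.
move=> lt21; split; first by rewrite mem_msupp_binomial eqxx.
by move=> m; rewrite mem_msupp_binomial => /orP[/eqP->|/eqP-> //]; rewrite eqxx.
Qed.

Lemma binomial_initial lt m : ~~ lt m1 m2 ->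
  is_initial lt ('X_[m1] - 'X_[m2] : R) m -> m = m1.
Proof.
move=> nlt [+ maxm]; rewrite mem_msupp_binomial => /orP[/eqP // | /eqP Em].
have : lt m1 m by apply: maxm; rewrite ?mem_msupp_binomial ?eqxx // Em.
by rewrite Em (negPf nlt).
Qed.

End Binomials.

End IdealSpans.

(** Each comparison has a deciding variable. The larger of the two contradicts the other comparison,
    which demands equal exponents there. *)
Lemma lex_lt_asym k (gt : rel 'I_k) m1 m2 :
  (forall i j, i != j -> gt i j || gt j i) ->
  lex_lt gt m1 m2 -> ~~ lex_lt gt m2 m1.
Proof.
move=> tot /existsP[i /andP[lti /forallP eqi]].
apply/existsP=> -[j /andP[ltj /forallP eqj]].
have [E|neq] := eqVneq i j; first by move: lti; rewrite E ltnNge ltnW.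
case/orP: (tot _ _ neq) => g.
- by have := eqj i; rewrite g => /eqP E; rewrite E ltnn in lti.
- by have := eqi j; rewrite g => /eqP E; rewrite E ltnn in ltj.
Qed.

Lemma product_lt_asym k l (ltl : rel 'X_{1..k}) (ltr : rel 'X_{1..l}) m1 m2 :
  (forall m m', ltl m m' -> ~~ ltl m' m) ->
  (forall m m', ltr m m' -> ~~ ltr m' m) ->
  product_lt ltl ltr m1 m2 -> ~~ product_lt ltl ltr m2 m1.
Proof.
move=> asl asr.
have irl m : ~~ ltl m m by apply/negP=> lt; have := asl _ _ lt; rewrite lt.
rewrite /product_lt => /orP[lt12 | /andP[/eqP E lt12]].
  rewrite (negPf (asl _ _ lt12)) /=; apply/nandP; left.
  by apply: contraTneq lt12 => ->.
by rewrite E eqxx (negPf (irl _)) (negPf (asr _ _ lt12)).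
Qed.

(** * Monomials of the Rees algebra *)

Section ReesMonomials.
Context {K : fieldType} {d : Order.disp_t} {L : finMeetSemilatticeType d}.
Context {n : nat} (p : 'I_n -> jirr L).
Implicit Types (a b c : L) (i j : 'I_n).
Local Notation R := {mpoly K[(n + n) + #|L|]}.
Local Notation M := 'X_{1..(n + n) + #|L|}.

Definition xv i : 'I_((n + n) + #|L|) := lshift #|L| (lshift n i).
Definition yv i : 'I_((n + n) + #|L|) := lshift #|L| (rshift n i).
Definition zv a : 'I_((n + n) + #|L|) := rshift (n + n) (enum_rank a).

Lemma var_eqE : (forall i j, (xv i == xv j) = (i == j)) *
  (forall i j, (yv i == yv j) = (i == j)) *
  (forall a b, (zv a == zv b) = (a == b)) *
  (forall i j, (xv i == yv j) = false) * (forall i j, (yv i == xv j) = false) *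
  (forall i a, (xv i == zv a) = false) * (forall i a, (zv a == xv i) = false) *
  (forall i a, (yv i == zv a) = false) * (forall i a, (zv a == yv i) = false).
Proof.
do ![split]=> u v; rewrite ?eq_lshift ?eq_rshift ?eq_lrshift ?eq_rlshift //.
by rewrite (inj_eq enum_rank_inj).
Qed.

Lemma var_ind (Q : 'I_((n + n) + #|L|) -> Prop) :
  (forall i, Q (xv i)) -> (forall i, Q (yv i)) -> (forall a, Q (zv a)) ->
  forall v, Q v.
Proof.
move=> Qx Qy Qz v; rewrite -(splitK v); case: (split v) => [w | w] /=.
  by rewrite -(splitK w); case: (split w).
by rewrite -(enum_valK w); apply: Qz.
Qed.

Definition u_exp a : 'X_{1..n + n} :=
  [multinom match split v with
            | inl i => (val (p i) <= a)%O : nat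
            | inr i => ~~ (val (p i) <= a)%O : nat
            end | v < n + n].

Lemma u_monomial a : u p a = 'X_[u_exp a] :> {mpoly K[n + n]}.
Proof.
rewrite /u !mprodXE -mpolyXD; congr 'X_[_]; apply/mnmP=> v.
rewrite mnmDE !mnm_sumE /u_exp mnmE -(splitK v).
have delta (Q : pred 'I_n) i :
    (\sum_(j < n | Q j) (j == i) = Q i)%N.
  by rewrite big_mkcond (bigD1 i) //= big1 ?addn0 => [|j /negPf->];
    rewrite ?eqxx; case: ifP.
case: (split v) => i; rewrite unsplitK /=.
- rewrite [X in (_ + X)%N]big1 ?addn0 => [|j _]; last by rewrite mnm1E eq_rlshift.
  rewrite -[RHS](delta (fun j => (val (p j) <= a)%O)).
  by apply: eq_big => j; rewrite ?inE // mnm1E eq_lshift.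
- rewrite [X in (X + _)%N]big1 ?add0n => [|j _]; last by rewrite mnm1E eq_lrshift.
  rewrite -[RHS](delta (fun j => ~~ (val (p j) <= a)%O)).
  by apply: eq_big => j; rewrite ?inE // mnm1E eq_rshift.
Qed.

Definition var_exp (v : 'I_((n + n) + #|L|)) : 'X_{1..n + n} :=
  match split v with inl i => U_(i)%MM | inr j => u_exp (enum_val j) end.

Definition phi_exp (m : M) : 'X_{1..n + n} := (\sum_v var_exp v *+ m v)%MM.

Definition zdeg (m : M) : nat := (\sum_a m (zv a))%N.

Definition phi_var (v : 'I_((n + n) + #|L|)) : {poly {mpoly K[n + n]}} :=
  match split v with
  | inl i => ('X_i)%:P
  | inr j => (u p (enum_val j))%:P * 'X
  end.

Lemma phi_varE (m : M) :
  mmap1 phi_var m = ('X_[phi_exp m] : {mpoly K[n + n]})%:P * 'X^(zdeg m).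
Proof.
rewrite /mmap1 /phi_exp -mprodXnE.
have -> : zdeg m = (\sum_(v : 'I_((n + n) + #|L|)) (n + n <= v) * m v)%N.
  rewrite big_split_ord /= big1 ?add0n => [|v _]; last by rewrite leqNgt ltn_ord.
  rewrite /zdeg (reindex (@enum_rank L)) /=; last exact/onW_bij/enum_rank_bij.
  by apply: eq_bigr => a _; rewrite leq_addr mul1n.
rewrite -prodrXr rmorph_prod -big_split /=; apply: eq_bigr => v _.
rewrite rmorphXn exprM -exprMn; congr (_ ^+ _).
rewrite /phi_var /var_exp; case: splitP => w ->; first by rewrite leqNgt ltn_ord mulr1.
by rewrite leq_addr u_monomial.
Qed.

Lemma phi_monomial (m : M) :
  phi p 'X_[m] = ('X_[phi_exp m] : {mpoly K[n + n]})%:P * 'X^(zdeg m).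
Proof. by rewrite /phi mmapX -phi_varE. Qed.

Lemma phi_expE (m : M) :
  (forall i, phi_exp m (lshift n i) =
     m (xv i) + \sum_a (val (p i) <= a)%O * m (zv a))%N *
  (forall i, phi_exp m (rshift n i) =
     m (yv i) + \sum_a ~~ (val (p i) <= a)%O * m (zv a))%N.
Proof.
have E w : (phi_exp m w = m (lshift #|L| w) + \sum_a u_exp a w * m (zv a))%N.
  rewrite /phi_exp mnm_sumE big_split_ord /=; congr addn.
    rewrite (bigD1 w) //= big1 ?addn0 => [|j neq];
      rewrite mulmnE /var_exp (unsplitK (inl _)) mnm1E ?eqxx ?mul1n //.
    by rewrite (negPf neq).
  rewrite (reindex (@enum_rank L)) /=; last exact/onW_bij/enum_rank_bij.
  by apply: eq_bigr => a _; rewrite mulmnE /var_exp (unsplitK (inr _)) enum_rankK.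
by split=> i; rewrite E; congr addn; apply: eq_bigr => a _;
  rewrite mnmE ?(unsplitK (inl _)) ?(unsplitK (inr _)).
Qed.

(** This is the toric structure of [J_ideal]: [phi] maps monomials to monomials, so a coefficient of
    the image collects those of [f] over one fibre. *)
Lemma coef_phi (f : R) N s :
  (phi p f)`_N@_s =
  \sum_(m <- msupp f | (phi_exp m == s) && (zdeg m == N)) f@_m.
Proof.
rewrite /phi /mmap coef_sum raddf_sum [RHS]big_mkcond /=; apply: eq_bigr => m _.
rewrite -/phi_var phi_varE coefCM coefCM coefXn mcoeffCM.
rewrite (eq_sym N); case: (zdeg m == N); last by rewrite mulr0 raddf0 mulr0 andbF.
by rewrite mulr1 mcoeffX andbT; case: ifP; rewrite ?mulr1 ?mulr0.
Qed.

(** The coefficients of [f] over the fibre of [m] sum to zero, so the support cannot meet this fibre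
    in [m] alone. *)
Lemma J_ideal_fibre (f : R) m : J_ideal p f -> m \in msupp f ->
  exists m', [/\ m' \in msupp f, m' != m, phi_exp m' = phi_exp m
    & zdeg m' = zdeg m].
Proof.
move=> Jf mf; have := coef_phi f (zdeg m) (phi_exp m).
rewrite Jf coef0 mcoeff0 => E.
suff /hasP[m' m'f /and3P[neq /eqP E1 /eqP E2]] : has (fun m' =>
    [&& m' != m, phi_exp m' == phi_exp m & zdeg m' == zdeg m]) (msupp f).
  by exists m'.
apply: contraT => /hasPn none; have := mf; rewrite mcoeff_msupp.
move: E; rewrite big_mkcond /= (bigD1_seq m) ?msupp_uniq //= !eqxx.
rewrite big1_seq ?addr0 => [->|m' /andP[neq m'f]]; first by rewrite eqxx.
by have := none m' m'f; rewrite neq /=; case: ifP.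
Qed.

Lemma J_ideal_binomial m1 m2 : phi_exp m1 = phi_exp m2 -> zdeg m1 = zdeg m2 ->
  J_ideal p ('X_[m1] - 'X_[m2] : R).
Proof.
by move=> E1 E2; rewrite /J_ideal /phi mmapB -!/(phi p _) !phi_monomial E1 E2 subrr.
Qed.

End ReesMonomials.

Lemma ltn_sum_ex (I : finType) (F F' : I -> nat) :
  (\sum_i F i < \sum_i F' i)%N -> exists i, (F i < F' i)%N.
Proof.
move=> lt; apply/existsP; apply: contraLR lt; rewrite negb_exists => /forallP le.
by rewrite -leqNgt leq_sum // => i _; rewrite leqNgt.
Qed.

(** * Monomials of the Hibi and special linear relations *)

Section Relations.
Context {K : fieldType} {d : Order.disp_t} {L : finMeetSemilatticeType d}.
Context {n : nat} (p : 'I_n -> jirr L) (zlt : rel L).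
Hypothesis zlt_rank : rank_order zlt.
Implicit Types (a b c : L) (i j : 'I_n).
Local Notation R := {mpoly K[(n + n) + #|L|]}.
Local Notation M := 'X_{1..(n + n) + #|L|}.

Definition xz i a : M := (U_(@xv d L n i) + U_(zv a))%MM.
Definition yz i a : M := (U_(@yv d L n i) + U_(zv a))%MM.
Definition zz a b : M := (U_(@zv d L n a) + U_(zv b))%MM.

Lemma xzE i a : (forall j, xz i a (xv j) = (i == j)) *
  (forall j, xz i a (yv j) = 0%N) * (forall b, xz i a (zv b) = (a == b)).
Proof. by do !split=> *; rewrite mnmDE !mnm1E !var_eqE ?addn0. Qed.

Lemma yzE i a : (forall j, yz i a (xv j) = 0%N) *
  (forall j, yz i a (yv j) = (i == j)) * (forall b, yz i a (zv b) = (a == b)).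
Proof. by do !split=> *; rewrite mnmDE !mnm1E !var_eqE ?addn0. Qed.

Lemma zzE a b : (forall j, zz a b (xv j) = 0%N) * (forall j, zz a b (yv j) = 0%N) *
  (forall c, zz a b (zv c) = (a == c) + (b == c))%N.
Proof. by do !split=> *; rewrite mnmDE !mnm1E !var_eqE ?addn0. Qed.

Lemma linear_binomial i a b :
  x_ i * z_ a - y_ i * z_ b = 'X_[xz i a] - 'X_[yz i b] :> R.
Proof. by rewrite !mpolyXD. Qed.

Lemma hibi_binomialE a b c :
  hibi_binomial a b c = 'X_[zz a b] - 'X_[zz (a `&` b)%O c] :> R.
Proof. by rewrite !mpolyXD. Qed.

Lemma zzC a b : zz a b = zz b a.
Proof. exact: addmC. Qed.

Lemma lex1_asym m1 m2 : lex1 zlt m1 m2 -> ~~ lex1 (n := n) zlt m2 m1.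
Proof.
case: zlt_rank => irr _ tot _; apply: product_lt_asym => m m'; apply: lex_lt_asym.
  by move=> i j; rewrite neq_ltn.
move=> i j neq; rewrite orbC; apply: tot; apply: contra_neq neq; exact: enum_val_inj.
Qed.

Lemma mon_leftE (m : M) v : mon_left m v = m (lshift #|L| v).
Proof. exact: mnmE. Qed.

Lemma lex1_leftP (m m' : M) : reflect
    (exists2 v, (m (lshift #|L| v) < m' (lshift #|L| v))%N &
      forall w : 'I_(n + n), (w < v)%N -> m (lshift #|L| w) = m' (lshift #|L| w))
    (lex_lt (fun i j : 'I_(n + n) => (i < j)%N) (mon_left m) (mon_left m')).
Proof.
apply: (iffP existsP) => [[v /andP[]] | [v lt eqs]]; rewrite ?mnmE.
  move=> lt /forallP eqs; exists v => // w wv; apply/eqP.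
  by have := eqs w; rewrite wv !mnmE.
exists v; rewrite !mnmE lt /=; apply/forallP=> w; rewrite !mnmE.
by apply/implyP=> /eqs->.
Qed.

Lemma lex1_right (m m' : M) : mon_left m = mon_left m' ->
    (exists2 a, (m (zv a) < m' (zv a))%N &
      forall b, zlt a b -> m (zv b) = m' (zv b)) ->
  lex1 zlt m m'.
Proof.
move=> E [a lt eqs]; rewrite /lex1 /product_lt E eqxx; apply/orP; right.
apply/existsP; exists (enum_rank a); rewrite !mnmE lt /=.
apply/forallP=> w; apply/implyP; rewrite enum_rankK !mnmE => /eqs.
by rewrite /zv enum_valK => ->.
Qed.

Lemma lex1_linear i a b : lex1 zlt (yz i b) (xz i a).
Proof.
apply/orP; left; apply/lex1_leftP; exists (lshift n i).
  by rewrite -/(xv i) yzE xzE eqxx.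
move=> w; rewrite -(splitK w); case: (split w) => j /=.
  by rewrite -/(xv j) yzE xzE; case: eqVneq => // ->; rewrite ltnn.
by rewrite ltnNge (leq_trans (ltnW (ltn_ord i))) ?leq_addr.
Qed.

(** The [S]-parts are trivial, and [c] has larger rank than [a], [b] and their meet. So [z_c] is the
    largest variable involved, and the initial monomial is the one with meet and join. *)
Lemma lex1_hibi a b c : (a >< b)%O -> is_join a b c ->
  lex1 zlt (zz a b) (zz (a `&` b)%O c).
Proof.
case: zlt_rank => irr tr _ rk; rewrite /Order.comparable negb_or => /andP[nab nba].
move/is_joinP=> join_abc; have := join_abc c; rewrite lexx => /esym/andP[ac bc].
have ltac : (a < c)%O by rewrite lt_neqAle ac andbT; apply: contraNneq nba => ->.
have ltbc : (b < c)%O by rewrite lt_neqAle bc andbT; apply: contraNneq nab => ->.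
have ltmc : (a `&` b < c)%O := le_lt_trans (leIl _ _) ltac.
have nz e : (e < c)%O -> ~~ zlt c e.
  by move=> /rank_lt/rk ec; apply/negP=> ce; have := irr c; rewrite (tr _ _ _ ce ec).
apply: lex1_right.
  apply/mnmP=> v; rewrite !mon_leftE -(splitK v).
  by case: (split v) => i /=; rewrite -?/(xv i) -?/(yv i) !zzE.
exists c => [|e ce]; rewrite !zzE; first by rewrite eqxx !lt_eqF.
have ne x : (x < c)%O -> (x == e) = false.
  by move=> xc; apply: contraTF ce => /eqP <-; apply: nz.
have nce : (c == e) = false by apply: contraTF ce => /eqP <-; rewrite irr.
by rewrite nce !ne.
Qed.

Lemma sum_delta (F : L -> nat) a : (\sum_b F b * (a == b) = F a)%N.
Proof.
rewrite (bigD1 a) //= eqxx muln1 big1 ?addn0 // => b.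
by rewrite eq_sym => /negPf->; rewrite muln0.
Qed.

Lemma phi_linear i a b : p i \notin jirr_below a ->
    jirr_below b = p i |: jirr_below a -> injective p ->
  phi_exp p (xz i a) = phi_exp p (yz i b) /\ zdeg (xz i a) = zdeg (yz i b).
Proof.
move=> pia E p_inj.
have Eb j : (val (p j) <= b)%O = (i == j) || (val (p j) <= a)%O.
  by have /setP/(_ (p j)) := E; rewrite !inE (inj_eq p_inj) eq_sym.
have nia : (val (p i) <= a)%O = false by rewrite inE in pia; apply: negPf.
split; last first.
  by rewrite /zdeg; under eq_bigr do rewrite xzE -[nat_of_bool _]mul1n;
    under [RHS]eq_bigr do rewrite yzE -[nat_of_bool _]mul1n; rewrite !sum_delta.
apply/mnmP=> v; rewrite -(splitK v); case: (split v) => j /=;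
  rewrite !phi_expE xzE yzE;
  under eq_bigr do rewrite xzE; under [in RHS]eq_bigr do rewrite yzE;
  rewrite !sum_delta Eb; case: eqVneq => [<-|_]; by rewrite ?nia.
Qed.

(** The hypothesis is about sets because a join in a meet-semilattice may lie above further
    join-irreducibles, and then the two images differ. *)
Lemma phi_hibi a b c : jirr_below c = jirr_below a :|: jirr_below b ->
  phi_exp p (zz (a `&` b)%O c) = phi_exp p (zz a b) /\
  zdeg (n := n) (zz (a `&` b)%O c) = zdeg (zz a b).
Proof.
move=> E.
have sum_zz (F : L -> nat) e e' :
    (\sum_g F g * zz e e' (zv g) = F e + F e')%N.
  by under eq_bigr do rewrite zzE mulnDr; rewrite big_split /= !sum_delta.
have Ec j : (val (p j) <= c)%O = (val (p j) <= a)%O || (val (p j) <= b)%O.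
  by have /setP/(_ (p j)) := E; rewrite !inE.
split; last first.
  have zd e e' : zdeg (n := n) (zz e e') = 2.
    by rewrite /zdeg -[RHS](sum_zz (fun=> 1%N) e e'); apply: eq_bigr => g _; rewrite mul1n.
  by rewrite !zd.
apply/mnmP=> v; rewrite -(splitK v); case: (split v) => j /=;
  rewrite !phi_expE !sum_zz !zzE Ec lexI;
  by case: (val (p j) <= a)%O; case: (val (p j) <= b)%O.
Qed.

Lemma zz_le a b a' b' : a != b -> (zz a b <= zz a' b')%MM ->
  (a = a' /\ b = b') \/ (a = b' /\ b = a').
Proof.
move=> neq /mnm_lepP le.
have la : (a' == a) || (b' == a).
  by have := le (zv a); rewrite !zzE eqxx; case: (a' == a); case: (b' == a).
have lb : (a' == b) || (b' == b).
  by have := le (zv b); rewrite !zzE eqxx addn1; case: (a' == b); case: (b' == b).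
case/orP: la => /eqP Ea; case/orP: lb => /eqP Eb; [|by left|by right|];
  by rewrite -Ea -Eb eqxx in neq.
Qed.

Lemma zz_le_linear a b i a' : a != b ->
  ~~ (zz a b <= xz i a')%MM && ~~ (zz a b <= yz i a')%MM.
Proof.
move=> neq; rewrite -negb_or; apply/negP=> le.
have {}le e : (zz a b (zv e) <= (a' == e))%N.
  by case/orP: le => /mnm_lepP/(_ (zv e)); [rewrite xzE | rewrite yzE].
have Ea : a' = a by have := le a; rewrite zzE eqxx; case: (a' =P a).
have Eb : a' = b by have := le b; rewrite zzE eqxx addn1; case: (a' =P b).
by rewrite -Ea -Eb eqxx in neq.
Qed.

Lemma xz_le i a (m : M) : (xz i a <= m)%MM -> (0 < m (xv i))%N /\ (0 < m (zv a))%N.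
Proof.
by move/mnm_lepP=> le; split; [have := le (xv i)|have := le (zv a)];
  rewrite xzE eqxx.
Qed.

Lemma xz_ge i a (m : M) : (0 < m (xv i))%N -> (0 < m (zv a))%N -> (xz i a <= m)%MM.
Proof.
move=> mi ma; apply/mnm_lepP; apply: var_ind => [j|j|b]; rewrite xzE //.
- by case: eqVneq => // <-.
- by case: eqVneq => // <-.
Qed.

Lemma zz_ge a b (m : M) : a != b -> (0 < m (zv a))%N -> (0 < m (zv b))%N ->
  (zz a b <= m)%MM.
Proof.
move=> neq ma mb; apply/mnm_lepP; apply: var_ind => [j|j|c]; rewrite zzE //.
have [<-|_] := eqVneq a c; first by rewrite eq_sym (negPf neq).
by case: eqVneq => // <-.
Qed.

End Relations.

(** * A basis of relations forces a top element *)

Section UniqueMaximal.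
Context {K : fieldType} {d : Order.disp_t} {L : finMeetSemilatticeType d}.
Context {n : nat} (p : 'I_n -> jirr L) (zlt : rel L).
Hypothesis zlt_rank : rank_order zlt.
Hypothesis p_bij : bijective p.
Implicit Types (a b c : L) (i j : 'I_n).
Local Notation R := {mpoly K[(n + n) + #|L|]}.
Local Notation M := 'X_{1..(n + n) + #|L|}.

Lemma lex1_neq (m1 m2 : M) : lex1 zlt m1 m2 -> m2 != m1.
Proof.
by move=> lt; apply: contraTneq lt => ->; apply/negP=> lt;
  have := lex1_asym zlt_rank lt; rewrite lt.
Qed.

(* The monomial [z_a x^(b\a) y^(a\b)]. *)
Definition swap_exp a b : M :=
  [multinom match split v with
            | inl w => match split w with
                       | inl i => (val (p i) <= b)%O && ~~ (val (p i) <= a)%O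
                       | inr i => (val (p i) <= a)%O && ~~ (val (p i) <= b)%O
                       end : nat
            | inr w => a == enum_val w : nat
            end | v < (n + n) + #|L|].

Lemma swap_expE a b :
  (forall i, swap_exp a b (xv i) =
     (val (p i) <= b)%O && ~~ (val (p i) <= a)%O :> nat) *
  (forall i, swap_exp a b (yv i) =
     (val (p i) <= a)%O && ~~ (val (p i) <= b)%O :> nat) *
  (forall c, swap_exp a b (zv c) = (a == c) :> nat).
Proof.
split; [split|] => u; rewrite mnmE.
- by rewrite (unsplitK (inl _)) (unsplitK (inl _)).
- by rewrite (unsplitK (inl _)) (unsplitK (inr _)).
- by rewrite (unsplitK (inr _)) enum_rankK.
Qed.

Lemma phi_swap a b : phi_exp p (swap_exp a b) = phi_exp p (swap_exp b a) /\
  zdeg (swap_exp a b) = zdeg (swap_exp b a).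
Proof.
split; last first.
  have zd e e' : zdeg (swap_exp e e') = 1%N.
    rewrite /zdeg -[RHS](sum_delta (fun=> 1%N) e); apply: eq_bigr => g _.
    by rewrite swap_expE mul1n.
  by rewrite !zd.
have sum_swap (F : L -> nat) e e' :
    (\sum_g F g * swap_exp e e' (zv g) = F e)%N.
  by under eq_bigr do rewrite swap_expE; rewrite sum_delta.
apply/mnmP=> v; rewrite -(splitK v); case: (split v) => j /=;
  rewrite !phi_expE !sum_swap !swap_expE;
  by case: (val (p j) <= a)%O; case: (val (p j) <= b)%O.
Qed.

Lemma lex1_swap a b i : (val (p i) <= b)%O -> ~~ (val (p i) <= a)%O ->
    (forall j, (j < i)%N -> (val (p j) <= a)%O = (val (p j) <= b)%O) ->
  lex1 zlt (swap_exp b a) (swap_exp a b).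
Proof.
move=> ib ia eqs; apply/orP; left; apply/lex1_leftP; exists (lshift n i).
  by rewrite -/(xv i) !swap_expE ib ia andbF.
move=> w; rewrite -(splitK w); case: (split w) => j /=.
  by rewrite -/(xv j) !swap_expE => /eqs->; rewrite andbC.
by rewrite ltnNge (leq_trans (ltnW (ltn_ord i))) ?leq_addr.
Qed.

Section RelationBasis.
Variable G : seq R.
Hypothesis G_basis : groebner_basis (lex1 zlt) (J_ideal p) G.
Hypothesis G_relations : forall g, g \in G ->
  hibi_relation g \/ special_linear_relation p g.

Lemma maximal_not_swapped a b i : (forall c, ~~ (a < c)%O) ->
    (val (p i) <= b)%O -> ~~ (val (p i) <= a)%O ->
    (forall j, (j < i)%N -> (val (p j) <= a)%O = (val (p j) <= b)%O) ->
  False.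
Proof.
move=> maxa ib ia eqs; have lt := lex1_swap ib ia eqs.
have [E1 E2] := phi_swap a b.
have [_ /(_ 'X_[swap_exp a b])[+ _]] := G_basis; case.
  apply: ideal_span_sub; exists ('X_[swap_exp a b] - 'X_[swap_exp b a]), (swap_exp a b).
  split=> //; first exact: J_ideal_binomial.
  exact: (binomial_is_initial (lt := lex1 zlt) (lex1_neq lt) lt).
move=> s [sG Es]; have : initial_ideal (lex1 zlt) (fun g => g \in G) 'X_[swap_exp a b].
  by exists s.
case/monomial_in_initial_ideal=> g [m [gG gm mle]].
have mza c : (m (zv c) <= (a == c))%N.
  by have /mnm_lepP/(_ (zv c)) := mle; rewrite swap_expE.
case: (G_relations gG) => [[e [f [c [nef join_efc Eg]]]] | [a1 [a2 [j [ja1 Ea2 Eg]]]]].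
- have [neq12 nef' nmc] : [/\ zz e f != zz (e `&` f)%O c :> M, e != f & (e `&` f)%O != c].
    split; first by rewrite eq_sym (lex1_neq (lex1_hibi zlt_rank nef join_efc)).
      by apply: contraNneq nef => ->; apply: comparablexx.
    move/is_joinP/(_ c): join_efc; rewrite lexx => /esym/andP[ec _].
    apply: contraNneq nef => Ec; apply: le_comparable.
    by apply: le_trans ec _; rewrite -Ec leIr.
  have : (m == zz e f) || (m == zz (e `&` f)%O c).
    have [+ _] := gm; case: Eg => ->; rewrite hibi_binomialE ?opprB.
      by rewrite mem_msupp_binomial.
    by rewrite mem_msupp_binomial 1?eq_sym // orbC.
  (* Both monomials of a Hibi relation contain two different [z] variables, whereas [swap_exp a b]
     contains only [z_a]. So it does not matter which of them is initial. *)
  have two u v : u != v -> m != zz u v.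
    move=> neq; apply/eqP=> Em; case/eqP: neq.
    have Eu : a = u by have := mza u; rewrite Em zzE eqxx; case: (a =P u).
    have Ev : a = v by have := mza v; rewrite Em zzE eqxx addn1; case: (a =P v).
    by rewrite -Eu -Ev.
  by rewrite !(negPf (two _ _ _)).
have Em : m = xz j a1.
  move: gm; rewrite Eg linear_binomial; apply: binomial_initial.
    exact/lex1_neq/lex1_linear.
  exact/lex1_asym/lex1_linear.
rewrite Em in mza mle.
(* The only [z] variable available is [z_a], so the special linear relation starts at [a] and its
   [a2] lies strictly above the maximal [a]. *)
have Ea : a = a1 by have := mza a1; rewrite xzE eqxx; case: (a =P a1).
case/negP: (maxa a2); rewrite Ea lt_neqAle -jirr_below_subset.
rewrite [jirr_below a2]Ea2 subsetUr andbT.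
apply: contraNneq ja1 => ->; rewrite [_ \in _](_ : _ = (p j \in jirr_below a2)) //.
by rewrite [jirr_below a2]Ea2 setU11.
Qed.

(** At the least index where [a] and [b] differ, exactly one of them is above [p i];
    [maximal_not_swapped] is applied with the other one in the role of its [a]. *)
Lemma maximal_unique a b :
  (forall c, ~~ (a < c)%O) -> (forall c, ~~ (b < c)%O) -> a = b.
Proof.
move=> maxa maxb; apply/eqP; apply: contraT => neq.
have [p' pK p'K] := p_bij.
have /existsP[i0 di0] : [exists i, (val (p i) <= a)%O != (val (p i) <= b)%O].
  apply: contraT; rewrite negb_exists => /forallP eqs; case/eqP: neq.
  apply/jirr_below_inj/setP=> q; rewrite !inE; apply/eqP.
  by have := eqs (p' q); rewrite negbK p'K.
pose differ i := (val (p i) <= a)%O != (val (p i) <= b)%O.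
have [i di mini] := @arg_minnP _ i0 differ (@nat_of_ord n) di0.
have eqs j : (j < i)%N -> (val (p j) <= a)%O = (val (p j) <= b)%O.
  move=> ji; apply/eqP; apply: contraTT ji => dj.
  by rewrite -leqNgt mini.
move: di; rewrite /differ; case ia : (val (p i) <= a)%O; case ib : (val (p i) <= b)%O => // _.
  case: (@maximal_not_swapped b a i); rewrite ?ib // => j ji.
  by rewrite eqs.
by case: (@maximal_not_swapped a b i); rewrite ?ia.
Qed.

End RelationBasis.
End UniqueMaximal.

(** * The relations of a full ideal lattice *)

Section FullIdealLattice.
Context {d : Order.disp_t} {L : finMeetSemilatticeType d}.
Hypothesis hatL_URC : URC (hat L).
Hypothesis embed_surj : forall I : hat L, exists l : L, embed l = I.
Implicit Types (a b c l : L) (q r : jirr L).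

Lemma ideal_below (I : {set jirr L}) : poset_ideal I -> exists l, jirr_below l = I.
Proof.
move=> idI; have [l El] := embed_surj (mk_ideal idI).
by exists l; rewrite -[I]/(val (mk_ideal idI)) -El.
Qed.

Lemma embed_le a b : (embed a <= embed b)%O = (a <= b)%O.
Proof. by rewrite ideal_le jirr_below_subset. Qed.

(** As every ideal comes from [L], so does the union of the two down-sets; its element is an upper
    bound of [a] and [b], hence above [c]. *)
Lemma jirr_below_join a b c : is_join a b c ->
  jirr_below c = jirr_below a :|: jirr_below b.
Proof.
move/is_joinP=> join_abc.
have [l El] : exists l, jirr_below l = jirr_below a :|: jirr_below b.
  exact/ideal_below/(poset_idealU (jirr_below_ideal a) (jirr_below_ideal b)).
have := join_abc c; rewrite lexx => /esym/andP[ac bc].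
apply/eqP; rewrite eqEsubset subUset !jirr_below_subset.
by rewrite ac bc andbT -El jirr_below_subset join_abc -!jirr_below_subset El subsetUl subsetUr.
Qed.

Lemma jirr_below_is_join a b c : jirr_below c = jirr_below a :|: jirr_below b ->
  is_join a b c.
Proof.
by move=> E; apply/is_joinP=> e; rewrite -!jirr_below_subset E subUset.
Qed.

(** This is the existence half of the URC property: if [[a, c]] is not a chain, then [z_a z_c] is
    the initial monomial of a Hibi relation. *)
Lemma hibi_lead_exists a c x y : (a <= x)%O -> (x <= c)%O -> (a <= y)%O ->
    (y <= c)%O -> (x >< y)%O ->
  exists e f, [/\ (e >< f)%O, is_join e f c & (e `&` f = a)%O].
Proof.
move=> ax xc ay yc nxy.
have nxy' : (embed x >< embed y)%O by rewrite /Order.comparable !embed_le.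
rewrite -!embed_le in ax xc ay yc.
have [I [J [IJc IJa Ic Jc]]] := URC_complement hatL_URC ax xc ay yc nxy'.
have [e Ee] := embed_surj I; have [f Ef] := embed_surj J.
subst I J; exists e, f; split.
- rewrite /Order.comparable; apply/negP=> /orP[]; rewrite -embed_le => le.
    by case/eqP: Jc; rewrite -IJc join_r.
  by case/eqP: Ic; rewrite -IJc join_l.
- by apply: jirr_below_is_join; rewrite -[jirr_below c]/(val (embed c)) -IJc.
- by apply: jirr_below_inj; rewrite jirr_belowI -[RHS]/(val (embed a)) -IJa.
Qed.

(** The uniqueness half of the URC property: a Hibi relation is determined by its initial monomial.
    This makes the basis reduced. *)
Lemma hibi_lead_unique a b a' b' c : (a >< b)%O -> (a' >< b')%O ->
    is_join a b c -> is_join a' b' c -> (a `&` b = a' `&` b')%O ->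
  (a = a' /\ b = b') \/ (a = b' /\ b = a').
Proof.
move=> nab nab' join_ab join_ab' Emeet.
have E : [set embed a; embed b] = [set embed a'; embed b'].
  apply: (URC_complement_unique hatL_URC).
  - by rewrite /Order.comparable !embed_le.
  - by rewrite /Order.comparable !embed_le.
  - by apply: val_inj; rewrite !ideal_meet /= -!jirr_belowI Emeet.
  - by apply: val_inj; rewrite !ideal_join /= -(jirr_below_join join_ab)
      (jirr_below_join join_ab').
have embed_inj x y : embed x = embed y -> x = y.
  by move/(congr1 val)/jirr_below_inj.
have : embed a \in [set embed a'; embed b'] by rewrite -E set21.
have : embed b \in [set embed a'; embed b'] by rewrite -E set22.
have neq : a != b by apply: contraNneq nab => ->; apply: comparablexx.
case/set2P=> /embed_inj Eb; case/set2P=> /embed_inj Ea.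
- by rewrite Ea Eb eqxx in neq.
- by right.
- by left.
- by rewrite Ea Eb eqxx in neq.
Qed.

(** An element is above [c] as soon as it is above the maximal join-irreducibles of [c], and three
    of these would form an antichain. *)
Lemma two_maximal c :
  [\/ forall a, (c <= a)%O,
      exists q, forall a, (c <= a)%O = (val q <= a)%O |
      exists q r, [/\ (q >< r)%O,
        (forall a, (c <= a)%O = (val q <= a)%O && (val r <= a)%O) & maximal_in (jirr_below c) q /\ maximal_in (jirr_below c) r]].
Proof.
have above q : q \in jirr_below c -> exists2 r, maximal_in (jirr_below c) r & (q <= r)%O.
  move=> qc; have [r /= rc [qr maxr]] :=
    @maximal_above _ _ [pred r | r \in jirr_below c] q qc.
  by exists r => //; split=> // s sc; apply: contraL sc; apply: maxr.
have leP a : (forall q, maximal_in (jirr_below c) q -> (val q <= a)%O) -> (c <= a)%O.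
  move=> H; rewrite -jirr_below_subset; apply/subsetP=> q /above[r /H ra qr].
  by rewrite inE; apply: le_trans ra.
case: (pickP [pred q | q \in jirr_below c]) => [q0 /= /above[q maxq _] | none]; last first.
  by apply: Or31 => a; apply: leP => q [qc _]; have := none q; rewrite /= qc.
have qc : (val q <= c)%O by case: maxq; rewrite inE.
case: (pickP [pred r | (r \in jirr_below c) && ~~ (r <= q)%O])
    => [r0 /= /andP[/above[r maxr r0r] nr0q] | none].
  have rc : (val r <= c)%O by case: maxr; rewrite inE.
  have neq : q != r by apply: contraNneq nr0q => ->.
  apply: Or33; exists q, r; split=> //; first exact: maximal_in_incomparable maxq maxr neq.
  move=> a; apply/idP/andP => [ca | [qa ra]]; first by split; apply: le_trans ca.
  apply: leP => s maxs; have [-> // | nsq] := eqVneq s q.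
  have [-> // | nsr] := eqVneq s r.
  by have [] := URC_no_antichain3 hatL_URC (maximal_in_incomparable maxq maxr neq)
    (maximal_in_incomparable maxq maxs _) (maximal_in_incomparable maxr maxs _);
    rewrite 1?eq_sym.
apply: Or32; exists q => a; apply/idP/idP => [|qa]; first exact: le_trans.
apply: leP => s [sc _]; have /= := none s; rewrite sc /= => /negbFE sq.
exact: le_trans (sq : (val s <= val q)%O) qa.
Qed.

End FullIdealLattice.

(** * The relations form the reduced Gröbner basis *)

Section RelationsFormBasis.
Context {K : fieldType} {d : Order.disp_t} {L : finMeetSemilatticeType d}.
Context {n : nat} (p : 'I_n -> jirr L) (zlt : rel L).
Hypothesis hatL_URC : URC (hat L).
Hypothesis embed_surj : forall I : hat L, exists l : L, embed l = I.
Hypothesis zlt_rank : rank_order zlt.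
Hypothesis p_bij : bijective p.
Implicit Types (a b c : L) (i j : 'I_n) (q r : jirr L).
Local Notation R := {mpoly K[(n + n) + #|L|]}.
Local Notation M := 'X_{1..(n + n) + #|L|}.

Definition has_relation_lead (m : M) : Prop :=
  (exists a b i, [/\ p i \notin jirr_below a,
     jirr_below b = p i |: jirr_below a & (xz i a <= m)%MM]) \/
  (exists a b c, [/\ (a >< b)%O, is_join a b c & (zz (a `&` b)%O c <= m)%MM]).

(** Take a minimal [q] whose [x]-exponent is larger in [m]; then [m] has fewer factors [z_a] above
    [q] than [m']. If [r] is the greatest element below [q], minimality of [q] gives [m] at least as
    many factors above [r] as [m'], so some factor [z_a] of [m] is above [r] but not above [q]. If
    nothing is below [q], the total degree in the [z]'s replaces the count for [r]. *)
Lemma linear_lead (m m' : M) i : phi_exp p m' = phi_exp p m -> zdeg m' = zdeg m ->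
  (m' (xv i) < m (xv i))%N -> has_relation_lead m.
Proof.
have [p' pK p'K] := p_bij => Ephi Ez lti.
pose Q q := (m' (xv (p' q)) < m (xv (p' q)))%N.
have [|q Qq [_ minq]] := @minimal_below _ _ Q (p i); first by rewrite /Q pK.
pose N (x : M) r := (\sum_a (val r <= a)%O * x (zv a))%N.
have EN r : (m (xv (p' r)) + N m r = m' (xv (p' r)) + N m' r)%N.
  have /mnmP/(_ (lshift n (p' r))) := Ephi.
  by rewrite !phi_expE p'K => <-.
have ltN : (N m q < N m' q)%N.
  by rewrite -(ltn_add2l (m (xv (p' q)))) EN ltn_add2r.
have [a [ma qa lowa]] : exists a, [/\ (0 < m (zv a))%N, ~~ (val q <= a)%O
    & forall r, (r < q)%O -> (val r <= a)%O].
  have [minq' | [r rq lowr]] := URC_lower_max hatL_URC q.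
    have [a] : exists a, ((val q <= a)%O * m (zv a) < m (zv a))%N.
      apply: ltn_sum_ex; apply: leq_trans ltN _; rewrite -[X in (_ <= X)%N]Ez.
      by apply: leq_sum => a _; case: (val q <= a)%O; rewrite ?mul1n.
    case: (boolP (val q <= a)%O) => [_|qa]; rewrite ?mul1n ?ltnn // => ma.
    by exists a; split=> // r rq; have := minq' r; rewrite rq.
  have [a] : exists a, ((val q <= a)%O * m (zv a) < (val r <= a)%O * m (zv a))%N.
    apply: ltn_sum_ex; apply: leq_trans ltN _.
    have leN : (N m' r <= N m r)%N.
      have := minq r rq; rewrite /Q -leqNgt => le.
      by rewrite -(leq_add2l (m (xv (p' r)))) EN leq_add2r.
    apply: leq_trans leN; apply: leq_sum => a _; apply: leq_mul => //.
    case: (boolP (val q <= a)%O) => // qa.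
    by rewrite (le_trans (ltW rq : (val r <= val q)%O) qa).
  case: (boolP (val q <= a)%O) => qa.
    by case: (val r <= a)%O; rewrite ?mul1n ?ltnn.
  case: (boolP (val r <= a)%O) => ra; rewrite ?mul1n // => ma.
  exists a; split=> // s sq.
  exact: le_trans (lowr s sq : (val s <= val r)%O) ra.
have [|b Eb] := @ideal_below _ _ embed_surj (q |: jirr_below a).
  apply/poset_idealP=> x y; rewrite !inE => /predU1P[-> yq | xa yx].
    by have [//|neq] := eqVneq y q; rewrite lowa // lt_neqAle neq.
  by rewrite (le_trans (yx : (val y <= val x)%O) xa) orbT.
left; exists a, b, (p' q); rewrite p'K; split=> //; first by rewrite inE.
by apply: xz_ge => //; apply: leq_ltn_trans Qq.
Qed.

(* Inclusion-exclusion for the two maximal elements [q], [r] of [c]: as [m'] has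
   fewer factors above [c] than [m], some factor of [m] is above neither. *)
Lemma hibi_lead (m m' : M) c : phi_exp p m' = phi_exp p m -> zdeg m' = zdeg m ->
    (forall i, m' (xv i) = m (xv i)) -> (m' (zv c) < m (zv c))%N ->
    (forall a, (c < a)%O -> m' (zv a) = m (zv a)) ->
  has_relation_lead m.
Proof.
have [p' pK p'K] := p_bij => Ephi Ez Ex ltc eqs.
pose N (x : M) (D : pred L) := (\sum_a D a * x (zv a))%N.
(* The [x]-exponents of [m] and [m'] agree, so both have equally many factors above each
   join-irreducible. *)
have EN q : N m' (fun a => val q <= a)%O = N m (fun a => val q <= a)%O.
  have /mnmP/(_ (lshift n (p' q))) := Ephi.
  by rewrite !phi_expE p'K Ex => /addnI.
have ltN : (N m' (fun a => c <= a)%O < N m (fun a => c <= a)%O)%N.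
  rewrite /N (bigD1 c) //= [X in (_ < X)%N](bigD1 c) //= lexx !mul1n -addSn.
  apply: leq_add => //; apply: leq_sum => a ac.
  by case ca: (c <= a)%O => //; rewrite eqs // lt_neqAle eq_sym ac.
have NE (x : M) (D D' : pred L) : D =1 D' -> N x D = N x D'.
  by move=> E; apply: eq_bigr => a _; rewrite E.
have [c_min | [q cq] | [q [r [nqr cqr [maxq maxr]]]]] := two_maximal hatL_URC c.
- have NT (x : M) : N x (fun a => c <= a)%O = zdeg x.
    by apply: eq_bigr => a _; rewrite c_min mul1n.
  by rewrite !NT Ez ltnn in ltN.
- by rewrite !(NE _ _ _ cq) EN ltnn in ltN.
have incl_excl (x : M) :
    (N x (fun a => val q <= a)%O + N x (fun a => val r <= a)%O =
     N x (fun a => c <= a)%O + N x (fun a => (val q <= a) || (val r <= a))%O)%N.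
  rewrite -!big_split /=; apply: eq_bigr => a _; rewrite cqr.
  by case: (val q <= a)%O; case: (val r <= a)%O; rewrite ?mul1n ?mul0n ?addn0.
have [a] : exists a, (((val q <= a)%O || (val r <= a)%O) * m (zv a) < m (zv a))%N.
  apply: ltn_sum_ex; rewrite -/(zdeg m) -Ez.
  apply: (@leq_trans (N m' (fun a => (val q <= a) || (val r <= a))%O)).
    have := incl_excl m'; rewrite !EN incl_excl => E.
    by rewrite -(ltn_add2l (N m (fun a => c <= a)%O)) -/(N m _) E ltn_add2r.
  by apply: leq_sum => a _; case: orb; rewrite ?mul1n.
case: (boolP (val q <= a)%O) => [_|qa]; rewrite ?mul1n ?ltnn //=.
case: (boolP (val r <= a)%O) => [_|ra]; rewrite ?mul1n ?ltnn // => ma.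
(* A join-irreducible below [a] but not below [c] would form a three-element antichain with [q] and
   [r]. *)
have ac : (a <= c)%O.
  rewrite -jirr_below_subset; apply/subsetP=> s; rewrite !inE => sa.
  have ncomp t : maximal_in (jirr_below c) t -> ~~ (val t <= a)%O ->
      ~~ (val s <= c)%O -> (t >< s)%O.
    move=> [tc _] ta sc; rewrite /Order.comparable negb_or; apply/andP; split.
      by apply: contra ta => ts; apply: le_trans (ts : (val t <= val s)%O) sa.
    apply: contra sc => st; apply: le_trans (st : (val s <= val t)%O) _.
    by rewrite inE in tc.
  apply: contraT => sc.
  by case: (URC_no_antichain3 hatL_URC nqr (ncomp q maxq qa sc) (ncomp r maxr ra sc)).
(* Deleting [q] or [r] from [c] gives two incomparable elements of [[a, c]], which is therefore not
   a chain. *)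
have del t : maximal_in (jirr_below c) t -> ~~ (val t <= a)%O ->
    exists2 l, jirr_below l = jirr_below c :\ t & (a <= l <= c)%O.
  move=> [tc maxt] ta; have [|l El] := @ideal_below _ _ embed_surj (jirr_below c :\ t).
    apply/poset_idealP=> x y; rewrite !in_setD1 => /andP[xt xc] yx.
    rewrite [y \in _](_ : _ = true); last first.
      by move: xc; rewrite !inE; apply: le_trans.
    rewrite andbT; apply: contraNneq (maxt x xc) => yt.
    by rewrite lt_neqAle eq_sym xt -yt.
  exists l => //; rewrite -!jirr_below_subset El subD1set andbT subsetD1.
  by rewrite jirr_below_subset ac inE.
have [lq Elq /andP[alq lqc]] := del q maxq qa.
have [lr Elr /andP[alr lrc]] := del r maxr ra.
have neq : q != r by apply: contraNneq nqr => ->; apply: comparablexx.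
have nl : (lq >< lr)%O.
  have [[qc _] [rc _]] := (maxq, maxr).
  rewrite /Order.comparable -!jirr_below_subset Elq Elr.
  by apply/negP=> /orP[/subsetP/(_ r)|/subsetP/(_ q)];
    rewrite !in_setD1 eqxx ?qc ?rc ?(eq_sym r) neq => /(_ isT).
have [e [f [nef join_efc Emeet]]] :=
  hibi_lead_exists hatL_URC embed_surj alq lqc alr lrc nl.
right; exists e, f, c; split=> //; rewrite Emeet; apply: zz_ge => //.
  by apply: contraNneq qa => ->; have [qc _] := maxq; rewrite inE in qc.
exact: leq_ltn_trans ltc.
Qed.

Lemma fibre_relation_lead (m m' : M) :
    phi_exp p m' = phi_exp p m -> zdeg m' = zdeg m -> lex1 zlt m' m ->
  has_relation_lead m.
Proof.
move=> Ephi Ez.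
(* Each factor [z_a] contributes exactly one of [x_i] and [y_i], and the numbers of such factors
   agree. Hence the first difference in the [S]-part cannot be at a [y] variable. *)
have Ey i : (m (xv i) + m (yv i) = m' (xv i) + m' (yv i))%N.
  apply: (@addIn (zdeg m)).
  have sumz (x : M) : (zdeg x = \sum_a (val (p i) <= a)%O * x (zv a) +
      \sum_a ~~ (val (p i) <= a)%O * x (zv a))%N.
    rewrite -big_split; apply: eq_bigr => a _ /=.
    by case: (val (p i) <= a)%O; rewrite mul1n ?addn0.
  have /mnmP/(_ (lshift n i)) := Ephi; have /mnmP/(_ (rshift n i)) := Ephi.
  rewrite !phi_expE => Hy Hx.
  by rewrite {1}sumz -Ez sumz addnACA [RHS]addnACA Hx Hy.
case/orP=> [/lex1_leftP[v] | /andP[/eqP El]].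
  rewrite -(splitK v); case: (split v) => i /= lt eqs.
    exact: linear_lead Ephi Ez lt.
  have Exi : m' (xv i) = m (xv i).
    by apply: eqs; rewrite /= (leq_trans (ltn_ord i)) ?leq_addr.
  by have /eqP := Ey i; rewrite Exi eqn_add2l => /eqP E; rewrite -/(yv i) E ltnn in lt.
case/existsP=> v /andP[]; rewrite !mnmE -[v]enum_valK -!/(zv _) => lt /forallP eqs.
apply: (hibi_lead Ephi Ez _ lt) => [i | a ca].
  by have /mnmP/(_ (lshift n i)) := El; rewrite !mnmE.
case: zlt_rank => _ _ _ rk; apply/eqP.
by have := eqs (enum_rank a); rewrite !enum_rankK rk ?rank_lt //= !mnmE.
Qed.

Definition hibi_basis : seq R :=
  [seq 'X_[zz (t.1.1 `&` t.1.2)%O t.2] - 'X_[zz t.1.1 t.1.2] |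
    t <- enum {: L * L * L} & (t.1.1 >< t.1.2)%O && is_join t.1.1 t.1.2 t.2].

Definition linear_basis : seq R :=
  [seq 'X_[xz t.2 t.1.1] - 'X_[yz t.2 t.1.2] |
    t <- enum {: L * L * 'I_n} & (p t.2 \notin jirr_below t.1.1) &&
      (jirr_below t.1.2 == p t.2 |: jirr_below t.1.1)].

(** The indices record the initial monomial and the other one; Hibi binomials carry the sign that
    makes them monic. *)
Variant relation_spec : R -> M -> M -> Prop :=
| HibiSpec a b c of (a >< b)%O & is_join a b c :
    relation_spec ('X_[zz (a `&` b)%O c] - 'X_[zz a b]) (zz (a `&` b)%O c) (zz a b)
| LinearSpec a b i of p i \notin jirr_below a & jirr_below b = p i |: jirr_below a :
    relation_spec ('X_[xz i a] - 'X_[yz i b]) (xz i a) (yz i b).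

Lemma basisP g : reflect (exists m1 m2, relation_spec g m1 m2)
  (g \in hibi_basis ++ linear_basis).
Proof.
rewrite mem_cat; apply: (iffP orP) => [[] /mapP[[[a b] c]] | [m1 [m2 []]]].
- rewrite mem_filter /= => /andP[/andP[nab join_abc] _] ->.
  by do 2!eexists; apply: HibiSpec.
- rewrite mem_filter /= => /andP[/andP[ni /eqP E] _] ->.
  by do 2!eexists; apply: LinearSpec.
- move=> a b c nab join_abc; left; apply/mapP; exists (a, b, c) => //.
  by rewrite mem_filter mem_enum nab join_abc.
- move=> a b i ni E; right; apply/mapP; exists (a, b, i) => //.
  by rewrite mem_filter mem_enum /= ni E eqxx.
Qed.

Lemma relation_spec_binomial g m1 m2 : relation_spec g m1 m2 ->
  [/\ g = 'X_[m1] - 'X_[m2], lex1 zlt m2 m1, phi_exp p m1 = phi_exp p m2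
    & zdeg m1 = zdeg m2].
Proof.
case=> [a b c nab join_abc | a b i ni E].
  have [E1 E2] := phi_hibi p (jirr_below_join embed_surj join_abc).
  by split=> //; apply: lex1_hibi.
have [E1 E2] := phi_linear ni E (bij_inj p_bij).
by split=> //; apply: lex1_linear.
Qed.

(** Relations of different kinds are separated by the [x] variables and the degree in the [z]'s. Two
    Hibi relations with the same initial monomial coincide by [hibi_lead_unique], and their other
    monomials involve incomparable elements, unlike the initial ones. For special linear relations,
    [i] and [a] determine [b]. *)
Lemma relation_spec_reduced g h m1 m2 m1' m2' :
    relation_spec g m1 m2 -> relation_spec h m1' m2' -> g != h ->
  ~~ (m1 <= m1')%MM && ~~ (m1 <= m2')%MM.
Proof.
have meet_lt a b c : (a >< b)%O -> is_join a b c -> (a `&` b < c)%O.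
  move=> nab /is_joinP/(_ c); rewrite lexx => /esym/andP[ac bc].
  rewrite lt_neqAle (le_trans (leIl _ _) ac) andbT.
  apply: contraNneq nab => E; apply: le_comparable.
  by apply: le_trans ac _; rewrite -E leIr.
have xz_zz i a b c : ~~ (@xz _ L n i a <= zz b c)%MM.
  by apply/negP=> /xz_le[]; rewrite zzE.
case=> [a b c nab join_abc | a b i ni E].
- have nmc : (a `&` b)%O != c by rewrite (lt_eqF (meet_lt _ _ _ nab join_abc)).
  case=> [a' b' c' nab' join_abc' | a' b' i' _ _] neq; last first.
    by have /andP[-> _] := zz_le_linear i' a' nmc;
      have /andP[_ ->] := zz_le_linear i' b' nmc.
  have ltmc := meet_lt _ _ _ nab join_abc.
  apply/andP; split; apply/negP=> /(zz_le nmc)[[E1 E2]|[E1 E2]].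
  + subst c'; case/eqP: neq.
    have [[-> ->]|[-> ->]] // :=
      hibi_lead_unique hatL_URC embed_surj nab nab' join_abc join_abc' E1.
    by rewrite [zz b' a']zzC meetC.
  + have := meet_lt _ _ _ nab' join_abc'; rewrite -E1 -E2 => lt.
    by have := lt_trans lt ltmc; rewrite ltxx.
  + by move: nab'; rewrite -E1 -E2 /Order.comparable (ltW ltmc).
  + by move: nab'; rewrite -E1 -E2 /Order.comparable (ltW ltmc) orbT.
case=> [a' b' c' nab' join_abc' | a' b' i' ni' E'] neq; first by rewrite !xz_zz.
apply/andP; split; apply/negP=> /xz_le[]; last by rewrite yzE.
rewrite !xzE; case: (i' =P i) => // Ei _; case: (a' =P a) => // Ea _.
subst i' a'; case/eqP: neq; congr (_ - 'X_[yz i _]).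
by apply: jirr_below_inj; rewrite E E'.
Qed.

Lemma relations_reduced_groebner_basis :
  reduced_groebner_basis (lex1 zlt) (J_ideal p) (hibi_basis ++ linear_basis).
Proof.
have lead g m1 m2 m : relation_spec g m1 m2 -> is_initial (lex1 zlt) g m -> m = m1.
  case/relation_spec_binomial=> -> lt _ _; apply: binomial_initial.
    exact: lex1_neq lt.
  exact: lex1_asym.
split.
- apply: groebner_basis_divides =>
    [g /basisP[m1 [m2 /relation_spec_binomial[-> lt E1 E2]]] | f m Jf fm].
    by split; [apply: J_ideal_binomial | apply: binomial_neq0; apply: lex1_neq lt].
  have [mf maxm] := fm.
  have [m' [m'f neq E1 E2]] := J_ideal_fibre Jf mf.
  suff [g [m1 [m2 [gspec m1m]]]] : exists g m1 m2, relation_spec g m1 m2 /\ (m1 <= m)%MM.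
    exists g, m1; split=> //; first by apply/basisP; exists m1, m2.
    have [-> lt _ _] := relation_spec_binomial gspec.
    by apply: binomial_is_initial => //; apply: lex1_neq lt.
  case: (fibre_relation_lead E1 E2 (maxm _ m'f neq)) =>
    [[a [b [i [ni E le]]]]|[a [b [c [nab J le]]]]].
    by do 3!eexists; split; [apply: LinearSpec ni E | apply: le].
  by do 3!eexists; split; [apply: HibiSpec nab J | apply: le].
- move=> g m /basisP[m1 [m2 gspec]] gm; rewrite (lead _ _ _ _ gspec gm).
  have [-> lt _ _] := relation_spec_binomial gspec.
  exact/binomial_coeff/lex1_neq/lt.
move=> g h m m' /basisP[m1 [m2 gspec]] /basisP[m1' [m2' hspec]] neq gm.
rewrite (lead _ _ _ _ gspec gm).
have /andP[n1 n2] := relation_spec_reduced gspec hspec neq.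
have [-> lt _ _] := relation_spec_binomial hspec.
by rewrite mem_msupp_binomial ?(lex1_neq zlt_rank lt) // => /orP[]/eqP->.
Qed.

Lemma basis_relations g : g \in hibi_basis ++ linear_basis ->
  hibi_relation g \/ special_linear_relation p g.
Proof.
case/basisP=> m1 [m2 [a b c nab J | a b i ni E]].
  by left; exists a, b, c; split=> //; right; rewrite hibi_binomialE opprB.
by right; exists a, b, i; split=> //; rewrite linear_binomial.
Qed.

End RelationsFormBasis.

Local Close Scope ring_scope.
Local Close Scope order_scope.

Theorem corollary3p4 (K : fieldType) (d : Order.disp_t)
    (L : finMeetSemilatticeType d) (L_nonempty : (0 < #|L|)%N)
    (L_md : meet_distributive L) (hatL_URC : URC (hat L))
    (n : nat) (p : 'I_n -> jirr L) (p_bij : bijective p)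
    (zlt : rel L) (zlt_rank : rank_order zlt) :
  (forall I : hat L, exists l : L, embed l = I) <->
  (exists G : seq {mpoly K[(n + n) + #|L|]},
     reduced_groebner_basis (lex1 zlt) (J_ideal p) G /\
     forall g, g \in G -> hibi_relation g \/ special_linear_relation p g).
Proof.
split=> [embed_surj | [G [[G_basis _ _] G_relations]] I].
  exists (hibi_basis ++ linear_basis p); split; last exact: basis_relations.
  exact: relations_reduced_groebner_basis.
have /card_gt0P[a0 _] := L_nonempty.
have [t _ [_ maxt]] := @maximal_above _ _ (@predT L) a0 isT.
(* Every element lies below some maximal one, and by [maximal_unique] that is [t]. All
   join-irreducibles are then below [t], so each ideal is a down-closed subset of [jirr_below t]. *)
have top a : (a <= t)%O.
  have [b _ [ab maxb]] := @maximal_above _ _ (@predT L) a isT.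
  suff -> : t = b by [].
  by apply: (maximal_unique zlt_rank p_bij G_basis G_relations) => c;
    apply/negP=> lt; [have := maxt c lt | have := maxb c lt].
have [|l El] := jirr_below_down_closed L_md hatL_URC (valP I) (a := t).
  by apply/subsetP=> q _; rewrite inE top.
by exists l; apply: val_inj.
Qed.
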